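(* The set $\operatorname{cPol}(\{B_n : n \geq 2\})$ is the class $T$ of all threshold functions. Moreover, for every clone $C$ of Boolean functions, the class $C \cap T$ is characterized by the set of relational constraints $\{B_n : n \geq 2\} \cup \mathcal{Q}_C$, i.e., $C \cap T = \operatorname{cPol}(\{B_n : n\ge 2\} \cup \mathcal{Q}_C)$, where $\mathcal{Q}_C$ is the set of relational constraints characterizing the clone $C$ listed in the context.
   Context: Let $\mathbb{B} = \{0,1\}$. A Boolean function is a map $f\colon \mathbb{B}^n \to \mathbb{B}$ with $n \ge 1$; $\Omega$ is the set of all Boolean functions. A clone is a subset of $\Omega$ containing all projections and closed under composition $f(g_1,\dots,g_n)(\mathbf{a}) = f(g_1(\mathbf{a}),\dots,g_n(\mathbf{a}))$. A Boolean function $f\colon\mathbb{B}^n\to\mathbb{B}$ is a threshold function if there are $w_1,\dots,w_n,t\in\mathbb{R}$ with $f(x_1,\dots,x_n)=1 \iff \sum_{i=1}^n w_i x_i \ge t$. $T$ is the set of all threshold functions. An $m$-ary relational constraint is a pair $(R,S)$ with $R,S\subseteq\mathbb{B}^m$. A function $f\colon\mathbb{B}^n\to\mathbb{B}$ preserves $(R,S)$ if for all $\mathbf{a}^1,\dots,\mathbf{a}^n\in R$ the tuple $f(\mathbf{a}^1,\dots,\mathbf{a}^n)$, whose $i$-th entry is $f(a^1_i,\dots,a^n_i)$, lies in $S$. For a set $\mathcal{Q}$ of relational constraints, $\operatorname{cPol}(\mathcal{Q})$ is the set of all Boolean functions preserving every member of $\mathcal{Q}$; a class $\mathcal{F}$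 is characterized by $\mathcal{Q}$ if $\mathcal{F}=\operatorname{cPol}(\mathcal{Q})$. For $n\ge1$, $B_n$ is the $2n$-ary relational constraint $(R(B_n),S(B_n))$ with $R(B_n)=\{(x_1,\dots,x_{2n})\in\mathbb{B}^{2n}: \sum_{i=1}^n x_i=\sum_{i=n+1}^{2n}x_i\}$ (sums in $\mathbb{R}$) and $S(B_n)=\mathbb{B}^{2n}\setminus\{(0,\dots,0,1,\dots,1),(1,\dots,1,0,\dots,0)\}$ (each block of length $n$). The sets $\mathcal{Q}_C$: ''characterized by the relation $R$'' means $\mathcal{Q}_C=\{(R,R)\}$; for a clone described as an intersection of other clones, $\mathcal{Q}_C$ is the union of the corresponding sets of constraints. The list of all clones of Boolean functions (Post's classes) is as follows. - $\Omega$: the empty relation. - $T_0=\{f: f(0,\dots,0)=0\}$: $\{0\}$; $T_1=\{f: f(1,\dots,1)=1\}$: $\{1\}$; $T_c=T_0\cap T_1$. - $M$ (monotone functions): $\{(0,0),(0,1),(1,1)\}$; $M_0=M\cap T_0$, $M_1=M\cap T_1$, $M_c=M\cap T_c$. - $S$ (self-dual functions, i.e. $f(x_1,\dots,x_n)=\overline{f(\overline{x}_1,\dots,\overline{x}_n)}$): $\{(0,1),(1,0)\}$; $S_c=S\cap T_c$, $SM=S\cap M$. - $L$ (functions $c_0\oplus c_1x_1\oplus\dots\oplus c_nx_n$): $\{(a,b,c,d): a\oplus b\oplus c=d\}$; $L_0=L\cap T_0$, $L_1=L\cap T_1$, $LS=L\cap S$, $L_c=L\cap T_c$. - A set $A\subseteq\mathbb{B}^n$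 is $a$-separating ($a \in \{0,1\}$) if there is $i$ such that every tuple of $A$ has $i$-th entry $a$; $f$ is $a$-separating if $f^{-1}(a)$ is, and $a$-separating of rank $m\ge2$ if every subset of $f^{-1}(a)$ of size at most $m$ is. For $m\ge2$, $U_m$ (resp. $W_m$) is the clone of all $1$-separating (resp. $0$-separating) functions of rank $m$: characterized by the $m$-ary relation $\mathbb{B}^m\setminus\{(1,\dots,1)\}$ (resp. $\mathbb{B}^m\setminus\{(0,\dots,0)\}$). $U_\infty=\bigcap_{k\ge2}U_k$, $W_\infty=\bigcap_{k\ge2}W_k$ (the $1$- and $0$-separating functions). For $m=2,\dots,\infty$: $T_cU_m=T_c\cap U_m$, $T_cW_m=T_c\cap W_m$, $MU_m=M\cap U_m$, $MW_m=M\cap W_m$, $M_cU_m=M_c\cap U_m$, $M_cW_m=M_c\cap W_m$. - $\Lambda$ (all conjunctions of variables, and constants): $\{(a,b,c): a\wedge b=c\}$; $\Lambda_0=\Lambda\cap T_0$, $\Lambda_1=\Lambda\cap T_1$, $\Lambda_c=\Lambda\cap T_c$. - $V$ (all disjunctions of variables, and constants): $\{(a,b,c): a\vee b=c\}$; $V_0=V\cap T_0$, $V_1=V\cap T_1$, $V_c=V\cap T_c$. - $\Omega(1)$ (all projections, negations of projections, and constants): $\{(a,b,c): a=b\text{ or }b=c\}$; $I^*=\Omega(1)\cap S$, $I=\Omega(1)\cap M$, $I_0=I\cap T_0$, $I_1=I\cap T_1$, $I_c=I\cap T_c$ (all projections). *)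

(* Defs.v *)
From mathcomp Require Import all_boot all_order all_algebra.
From mathcomp Require Import boolp classical_sets reals.

Set Implicit Arguments.
Unset Strict Implicit.
Unset Printing Implicit Defensive.

Local Open Scope classical_set_scope.

(* The arity is [apred f].+1, so that it is always positive. *)
Record bfun := BFun {
  apred : nat;
  fn :> {ffun apred.+1.-tuple bool -> bool} }.

Definition bproj n (i : 'I_n.+1) : bfun :=
  BFun [ffun x : n.+1.-tuple bool => tnth x i].

Definition bcomp n m (f : {ffun n.+1.-tuple bool -> bool})
    (g : 'I_n.+1 -> {ffun m.+1.-tuple bool -> bool}) : bfun :=
  BFun [ffun a : m.+1.-tuple bool => f [tuple g i a | i < n.+1]].

Definition clone (C : set bfun) : Prop :=
  (forall n (i : 'I_n.+1), C (bproj i)) /\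
  (forall n m (f : {ffun n.+1.-tuple bool -> bool})
     (g : 'I_n.+1 -> {ffun m.+1.-tuple bool -> bool}),
     C (BFun f) -> (forall i, C (BFun (g i))) -> C (bcomp f g)).

Definition threshold (R : realType) : set bfun :=
  [set f | exists (w : 'I_(apred f).+1 -> R) (t : R), forall x,
     f x = true <-> (t <= \sum_i w i * (tnth x i)%:R)%R].

Record constraint := Constraint {
  carity : nat;
  antecedent : set (carity.-tuple bool);
  consequent : set (carity.-tuple bool) }.
Arguments antecedent : clear implicits.
Arguments consequent : clear implicits.

Definition preserves (f : bfun) (q : constraint) : Prop :=
  forall a : 'I_(apred f).+1 -> (carity q).-tuple bool,
    (forall j, antecedent q (a j)) ->
    consequent q
      [tuple f [tuple tnth (a j) i | j < (apred f).+1] | i < carity q].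

Definition cPol (Q : set constraint) : set bfun :=
  [set f | forall q, Q q -> preserves f q].

Definition B (n : nat) : constraint :=
  @Constraint (n + n)
    [set x : (n + n).-tuple bool | (\sum_(i < n) tnth x (lshift n i) =
                                    \sum_(i < n) tnth x (rshift n i))%N]
    (~` [set [tuple of nseq n false ++ nseq n true];
             [tuple of nseq n true ++ nseq n false]]).

Definition Bs : set constraint := [set B n | n in [set n | (2 <= n)%N]].

(* An entry [(C, Q_C)] of the list of clones: a class of functions together
   with the constraints listed for it. *)
Definition entry := (set bfun * set constraint)%type.

Definition basic (C : set bfun) m (r : set (m.-tuple bool)) : entry :=
  (C, [set Constraint r r]).

Definition meet (e1 e2 : entry) : entry := (e1.1 `&` e2.1, e1.2 `|` e2.2).

Definition eOmega : entry := basic setT (set0 : set (1.-tuple bool)).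

Definition eT0 : entry :=
  basic [set f : bfun | f [tuple false | _ < (apred f).+1] = false]
        [set [tuple false]].
Definition eT1 : entry :=
  basic [set f : bfun | f [tuple true | _ < (apred f).+1] = true]
        [set [tuple true]].
Definition eTc : entry := meet eT0 eT1.

Definition monotone (f : bfun) : Prop :=
  forall x y : (apred f).+1.-tuple bool,
    (forall i, tnth x i -> tnth y i) -> f x -> f y.

Definition eM : entry :=
  basic monotone
    [set [tuple false; false]; [tuple false; true]; [tuple true; true]].
Definition eMc : entry := meet eM eTc.

Definition selfdual (f : bfun) : Prop :=
  forall x, f x = ~~ f [tuple ~~ tnth x i | i < (apred f).+1].

Definition eS : entry :=
  basic selfdual [set [tuple false; true]; [tuple true; false]].

Definition affine (f : bfun) : Prop :=
  exists (c0 : bool) (c : 'I_(apred f).+1 -> bool),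
    forall x, f x = c0 (+) \big[addb/false]_i (c i && tnth x i).

Definition eL : entry :=
  basic affine
    [set x | exists a b c d, x = [tuple a; b; c; d] /\ a (+) b (+) c = d].

Definition separating (a : bool) n (A : {set n.-tuple bool}) : Prop :=
  exists i, forall x, x \in A -> tnth x i = a.

Definition separating_rank (a : bool) (m : nat) : set bfun :=
  [set f | forall A : {set (apred f).+1.-tuple bool},
     (forall x, x \in A -> f x = a) -> (#|A| <= m)%N -> separating a A].

Definition eU (m : nat) : entry :=
  basic (separating_rank true m) (~` [set [tuple true | _ < m]]).
Definition eW (m : nat) : entry :=
  basic (separating_rank false m) (~` [set [tuple false | _ < m]]).

Definition meet_rank (e : nat -> entry) : entry :=
  (\bigcap_(k in [set k | (2 <= k)%N]) (e k).1,
   \bigcup_(k in [set k | (2 <= k)%N]) (e k).2).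

Definition eUoo : entry := meet_rank eU.
Definition eWoo : entry := meet_rank eW.

Definition constant_fun (f : bfun) : Prop := exists c, forall x, f x = c.

Definition conjunction (f : bfun) : Prop :=
  exists2 A : {set 'I_(apred f).+1}, A != finset.set0 &
    forall x, f x = \big[andb/true]_(i in A) tnth x i.

Definition disjunction (f : bfun) : Prop :=
  exists2 A : {set 'I_(apred f).+1}, A != finset.set0 &
    forall x, f x = \big[orb/false]_(i in A) tnth x i.

Definition eLambda : entry :=
  basic [set f | conjunction f \/ constant_fun f]
    [set x | exists a b c, x = [tuple a; b; c] /\ a && b = c].

Definition eV : entry :=
  basic [set f | disjunction f \/ constant_fun f]
    [set x | exists a b c, x = [tuple a; b; c] /\ a || b = c].

Definition eOmega1 : entry :=
  basic [set f : bfun | (exists i, forall x, f x = tnth x i) \/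
                        (exists i, forall x, f x = ~~ tnth x i) \/
                        constant_fun f]
    [set x | exists a b c, x = [tuple a; b; c] /\ (a = b \/ b = c)].
Definition eI : entry := meet eOmega1 eM.

Inductive rankU : entry -> Prop :=
| rankU_fin m : (2 <= m)%N -> rankU (eU m)
| rankU_oo : rankU eUoo.

Inductive rankW : entry -> Prop :=
| rankW_fin m : (2 <= m)%N -> rankW (eW m)
| rankW_oo : rankW eWoo.

Inductive post : entry -> Prop :=
| post_Omega : post eOmega
| post_T0 : post eT0
| post_T1 : post eT1
| post_Tc : post eTc
| post_M : post eM
| post_M0 : post (meet eM eT0)
| post_M1 : post (meet eM eT1)
| post_Mc : post eMc
| post_S : post eS
| post_Sc : post (meet eS eTc)
| post_SM : post (meet eS eM)
| post_L : post eL
| post_L0 : post (meet eL eT0)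
| post_L1 : post (meet eL eT1)
| post_LS : post (meet eL eS)
| post_Lc : post (meet eL eTc)
| post_U u : rankU u -> post u
| post_TcU u : rankU u -> post (meet eTc u)
| post_MU u : rankU u -> post (meet eM u)
| post_McU u : rankU u -> post (meet eMc u)
| post_W w : rankW w -> post w
| post_TcW w : rankW w -> post (meet eTc w)
| post_MW w : rankW w -> post (meet eM w)
| post_McW w : rankW w -> post (meet eMc w)
| post_Lambda : post eLambda
| post_Lambda0 : post (meet eLambda eT0)
| post_Lambda1 : post (meet eLambda eT1)
| post_Lambdac : post (meet eLambda eTc)
| post_V : post eV
| post_V0 : post (meet eV eT0)
| post_V1 : post (meet eV eT1)
| post_Vc : post (meet eV eTc)
| post_Omega1 : post eOmega1
| post_Istar : post (meet eOmega1 eS)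
| post_I : post eI
| post_I0 : post (meet eI eT0)
| post_I1 : post (meet eI eT1)
| post_Ic : post (meet eI eTc).

(* [Q_C]: the constraints of the entry listed for [C].  The listed classes are
   pairwise distinct, so at most one entry contributes to the union; that the
   list contains every clone is Post's theorem, and is not built in here. *)
Definition constraints_of (C : set bfun) : set constraint :=
  \bigcup_(e in [set e | post e /\ e.1 = C]) e.2.

(* Main.v *)
Require Import Defs.
From mathcomp Require Import all_boot all_order all_algebra.
From mathcomp Require Import boolp classical_sets reals.
From mathcomp Require Import zify lra.

(* A function preserves every [B n] iff no sequence of true points and sequence
   of false points of the same length have the same sum.  By Gordan's
   alternative, applied to the vectors (x, 1) for true x and -(x, 1) for false
   x, this is equivalent to the existence of a strictly separating hyperplane.

   For the clones one needs Post's theorem that the list contains every clone.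
   - If a clone C contains the conjunction and the disjunction, its n-ary part
     is a lattice, so it is determined by the pairs of points it separates.
   - If C contains the conjunction only, then C consists of conjunctions and
     constants, or every function of C is 1-separating of rank 2 and
     x /\ (y \/ z) is in C.  In the latter case the functions of C below a
     variable form a lattice, which determines the 1-separating functions of C;
     a near-unanimity operation of C, present as soon as C is not contained in
     U_(m+1), then glues them into the functions of U_m.
   - The case of the disjunction only is dual.
   - If C contains neither, its binary functions are affine.  Then either C
     consists of affine functions, or it consists of self-dual functions and
     contains the majority, so that it is determined by pairs of points. *)

Set Implicit Arguments.
Unset Strict Implicit.
Unset Printing Implicit Defensive.

Local Open Scope classical_set_scope.

(** * The classes in the list are characterized by their constraints *)

Definition characterized (e : entry) : Prop := cPol e.2 = e.1.

Lemma characterized_basic (C : set bfun) m (r : set (m.-tuple bool)) :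
  (forall f, preserves f (Constraint r r) <-> C f) -> characterized (basic C r).
Proof.
move=> H; apply/seteqP; split=> f /=; first by move=> fC; apply/H/fC.
by move=> fC q ->; apply/H.
Qed.

Lemma characterized_meet e1 e2 :
  characterized e1 -> characterized e2 -> characterized (meet e1 e2).
Proof.
rewrite /characterized /= => <- <-; apply/seteqP; split=> f.
  by move=> H; split=> q qe; apply: H; [left|right].
by move=> [H1 H2] q [/H1|/H2].
Qed.

Lemma characterized_meet_rank e :
  (forall k, characterized (e k)) -> characterized (meet_rank e).
Proof.
move=> H; apply/seteqP; split=> f.
  by move=> fP k k2; rewrite -[(e k).1]H => q qk; apply: fP; exists k.
by move=> fP q [k k2]; have := fP k k2; rewrite -[(e k).1]H; exact.
Qed.

(** Transposition: the definition takes the argument matrix by columns, each in [r], whereas here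
    its rows [X i] are the actual arguments of [f]. *)
Lemma preserves_rows m (r : set (m.-tuple bool)) f :
  preserves f (Constraint r r) <->
  forall X : 'I_m -> (apred f).+1.-tuple bool,
    (forall j, r [tuple tnth (X i) j | i < m]) -> r [tuple f (X i) | i < m].
Proof.
split=> [fP X XP|fP a aP /=].
  have := fP (fun j => [tuple tnth (X i) j | i < m]) XP.
  congr (r _); apply/eq_from_tnth => i; rewrite !tnth_mktuple; congr (f _).
  by apply/eq_from_tnth => j; rewrite !tnth_mktuple.
apply: (fP (fun i => [tuple tnth (a j) i | j < _])) => j.
suff -> : [tuple tnth [tuple tnth (a j0) i | j0 < (apred f).+1] j | i < m] = a j
  by apply: aP.
by apply/eq_from_tnth => i; rewrite !tnth_mktuple.
Qed.

(** This and the next three lemmas describe a relation of small arity by a predicate on its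
    coordinates, so that preservation becomes a pointwise implication between arguments and
    values. *)
Lemma preserves1 (P : bool -> Prop) (r : set (1.-tuple bool)) f :
  (forall t, r t <-> P (tnth t ord0)) ->
  preserves f (Constraint r r) <->
  forall x : (apred f).+1.-tuple bool, (forall j, P (tnth x j)) -> P (f x).
Proof.
move=> rP; rewrite preserves_rows; split=> [fP x xP|fP X XP].
  have := fP (fun=> x); rewrite rP tnth_mktuple; apply => j.
  by rewrite rP tnth_mktuple.
by rewrite rP tnth_mktuple; apply: fP => j; have := XP j; rewrite rP tnth_mktuple.
Qed.

Lemma preserves2 (P : bool -> bool -> Prop) (r : set (2.-tuple bool)) f :
  (forall t, r t <-> P (tnth t ord0) (tnth t ord_max)) ->
  preserves f (Constraint r r) <->
  forall x y : (apred f).+1.-tuple bool,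
    (forall j, P (tnth x j) (tnth y j)) -> P (f x) (f y).
Proof.
move=> rP; rewrite preserves_rows; split=> [fP x y xP|fP X XP].
  have := fP (tnth [tuple x; y]); rewrite rP !tnth_mktuple; apply => j.
  by rewrite rP !tnth_mktuple; apply: xP.
by rewrite rP !tnth_mktuple; apply: fP => j; have := XP j; rewrite rP !tnth_mktuple.
Qed.

Lemma preserves3 (P : bool -> bool -> bool -> Prop) (r : set (3.-tuple bool)) f :
  (forall t, r t <-> P (tnth t ord0) (tnth t (@Ordinal 3 1 isT)) (tnth t ord_max)) ->
  preserves f (Constraint r r) <->
  forall x y z : (apred f).+1.-tuple bool,
    (forall j, P (tnth x j) (tnth y j) (tnth z j)) -> P (f x) (f y) (f z).
Proof.
move=> rP; rewrite preserves_rows; split=> [fP x y z xP|fP X XP].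
  have := fP (tnth [tuple x; y; z]); rewrite rP !tnth_mktuple; apply => j.
  by rewrite rP !tnth_mktuple; apply: xP.
by rewrite rP !tnth_mktuple; apply: fP => j; have := XP j; rewrite rP !tnth_mktuple.
Qed.

Lemma preserves4 (P : bool -> bool -> bool -> bool -> Prop)
    (r : set (4.-tuple bool)) f :
  (forall t, r t <-> P (tnth t ord0) (tnth t (@Ordinal 4 1 isT))
                       (tnth t (@Ordinal 4 2 isT)) (tnth t ord_max)) ->
  preserves f (Constraint r r) <->
  forall x y z u : (apred f).+1.-tuple bool,
    (forall j, P (tnth x j) (tnth y j) (tnth z j) (tnth u j)) ->
    P (f x) (f y) (f z) (f u).
Proof.
move=> rP; rewrite preserves_rows; split=> [fP x y z u xP|fP X XP].
  have := fP (tnth [tuple x; y; z; u]); rewrite rP !tnth_mktuple; apply => j.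
  by rewrite rP !tnth_mktuple; apply: xP.
by rewrite rP !tnth_mktuple; apply: fP => j; have := XP j; rewrite rP !tnth_mktuple.
Qed.

Definition const_tuple n (b : bool) : n.-tuple bool := [tuple b | _ < n].
Definition neg n (x : n.-tuple bool) : n.-tuple bool := [tuple ~~ tnth x i | i < n].
Definition meett n (x y : n.-tuple bool) : n.-tuple bool :=
  [tuple tnth x i && tnth y i | i < n].
Definition addt n (x y : n.-tuple bool) : n.-tuple bool :=
  [tuple tnth x i (+) tnth y i | i < n].

Lemma characterized_Omega : characterized eOmega.
Proof.
apply: characterized_basic => f; split=> // _.
by rewrite (@preserves1 (fun=> False)) => // x /(_ ord0).
Qed.

Lemma characterized_const b :
  characterized (basic [set f : bfun | f [tuple b | _ < (apred f).+1] = b]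
                       [set [tuple b]]).
Proof.
apply: characterized_basic => f; rewrite (@preserves1 (fun c => c = b)).
  split=> [fP|fP x xb]; first by apply: fP => j; rewrite tnth_mktuple.
  by rewrite -[RHS]fP; congr (f _); apply/eq_from_tnth => j; rewrite tnth_mktuple.
by move=> t; split=> [->//|tb]; apply/eq_from_tnth => i; rewrite (ord1 i) tb.
Qed.

Lemma tuple2E (T : Type) (t : 2.-tuple T) : t = [tuple tnth t ord0; tnth t ord_max].
Proof. by apply/eq_from_tnth => -[[|[|]] // i]; congr (tnth _ _); apply/val_inj. Qed.

Lemma characterized_M : characterized eM.
Proof.
apply: characterized_basic => f; rewrite (@preserves2 (fun a b => a -> b)) => //.
move=> t; rewrite {1}[t]tuple2E; case: (tnth t _); case: (tnth t _).
- by split=> // _; right.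
- by split=> [[[|]|]/(congr1 val) //|/(_ isT)].
- by split=> // _; left; right.
- by split=> // _; left; left.
Qed.

Lemma characterized_S : characterized eS.
Proof.
apply: characterized_basic => f; rewrite (@preserves2 (fun a b => a = ~~ b)) => //.
  split=> [fP x|fP x y xy]; first by apply: fP => j; rewrite tnth_mktuple negbK.
  rewrite fP; congr (~~ f _); apply/eq_from_tnth => j.
  by rewrite tnth_mktuple xy negbK.
move=> t; rewrite {1}[t]tuple2E; case: (tnth t _); case: (tnth t _).
- by split=> [[|]/(congr1 val) //|].
- by split=> // _; right.
- by split=> // _; left.
- by split=> [[|]/(congr1 val) //|].
Qed.

(** Subsets of size at most [m] are traded for families indexed by ['I_m], in which repetitions are
    allowed. *)
Lemma separating_rankP b m (f : bfun) : separating_rank b m f <->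
  forall X : 'I_m -> (apred f).+1.-tuple bool, (forall i, f (X i) = b) ->
    exists j, forall i, tnth (X i) j = b.
Proof.
split=> [fP X XP|fP A Af Am].
  have [||j jP] := fP [set X i | i : 'I_m]%SET.
  - by move=> _ /imsetP[i _ ->].
  - by rewrite -[X in (_ <= X)%N]card_ord; apply: leq_imset_card.
  - by exists j => i; apply/jP/imset_f.
have [->|/set0Pn[x0 x0A]] := eqVneq A finset.set0.
  by exists ord0 => x; rewrite inE.
(* The default [x0] lies in [A]; it pads the family when [A] has fewer than [m] elements. *)
have [i|j jP] := fP (fun i : 'I_m => nth x0 (enum A) i).
  apply: Af; have [iA|iA] := ltnP i #|A|; last by rewrite nth_default // -cardE.
  by rewrite -mem_enum mem_nth // -cardE.
exists j => x xA.
have xm : (index x (enum A) < m)%N.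
  by apply: leq_trans Am; rewrite cardE index_mem mem_enum.
by rewrite -(jP (Ordinal xm)) nth_index ?mem_enum.
Qed.

Lemma characterized_separating b m :
  characterized (basic (separating_rank b m) (~` [set [tuple b | _ < m]])).
Proof.
apply: characterized_basic => f; rewrite preserves_rows separating_rankP.
split=> fP X XP.
  apply: contrapT => /forallNP jP; apply: (fP X) => [j E|].
    apply: (jP j) => i; have := congr1 (fun t => tnth t i) E.
    by rewrite !tnth_mktuple.
  by apply/eq_from_tnth => i; rewrite !tnth_mktuple.
move=> E; have [i|j jP] := fP X.
  by have := congr1 (fun t => tnth t i) E; rewrite !tnth_mktuple.
by apply: (XP j); apply/eq_from_tnth => i; rewrite !tnth_mktuple.
Qed.

(** For the converse, the coefficient of a variable is the sum of the values at zero and at its unit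
    vector. The value at [x] is built up one coordinate at a time, with the zero tuple [o] as third
    summand. *)
Lemma affineP (f : bfun) : affine f <-> forall x y z,
  f (addt (addt x y) z) = f x (+) f y (+) f z.
Proof.
split=> [[c0 [c fE]] x y z|fP].
  rewrite !fE (eq_bigr (fun i => (c i && tnth x i) (+) (c i && tnth y i)
    (+) (c i && tnth z i))).
    by rewrite !big_split /=; case: (c0); do 3 case: (\big[_/_]_i _).
  by move=> i _; rewrite !tnth_mktuple; case: (c i); rewrite // andbF.
pose n := (apred f).+1; pose o := const_tuple n false.
pose sel (p : pred 'I_n) (x : n.-tuple bool) := [tuple tnth x i && p i | i < n].
exists (f o), (fun i => f o (+) f (sel (pred1 i) (const_tuple n true))) => x.
have H (s : seq 'I_n) : uniq s -> f (sel (mem s) x) = f o (+)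
    \big[addb/false]_(i <- s) ((f o (+) f (sel (pred1 i) (const_tuple n true))) && tnth x i).
  elim: s => [_|i s IH /= /andP[si us]].
    rewrite big_nil addbF; congr (f _); apply/eq_from_tnth => j.
    by rewrite !tnth_mktuple andbF.
  rewrite big_cons addbCA -IH //.
  have -> : sel (mem (i :: s)) x = addt (addt (sel (mem s) x) (sel (pred1 i) x)) o.
    apply/eq_from_tnth => j; rewrite !tnth_mktuple /= inE addbF.
    by case: eqP => [->|_]; rewrite ?(negPf si); case: (tnth x _) => //=; case: (_ \in _).
  rewrite fP; case xi : (tnth x i).
    rewrite andbT -addbA addbC; congr (_ (+) _); rewrite addbC; congr (_ (+) f _).
    apply/eq_from_tnth => j; rewrite !tnth_mktuple /=.
    by case: eqP => [->|]; rewrite ?xi ?andbF.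
  rewrite andbF addFb -[RHS]addbF -addbA; congr (_ (+) _).
  suff -> : sel (pred1 i) x = o by rewrite addbb.
  apply/eq_from_tnth => j; rewrite !tnth_mktuple /=.
  by case: eqP => [->|]; rewrite ?xi ?andbF.
rewrite -(H (index_enum 'I_n)) ?index_enum_uniq//; congr (f _); apply/eq_from_tnth => j.
by rewrite tnth_mktuple /= mem_index_enum andbT.
Qed.

Lemma characterized_L : characterized eL.
Proof.
apply: characterized_basic => f.
rewrite (@preserves4 (fun a b c d => a (+) b (+) c = d)) => //.
  rewrite affineP; split=> [fP x y z|fP x y z u xP].
    by apply/esym/fP => j; rewrite !tnth_mktuple.
  by rewrite -fP; congr (f _); apply/eq_from_tnth => j; rewrite !tnth_mktuple.
move=> t; split=> [[a [b [c [d [-> <-]]]]] //|tP].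
exists (tnth t ord0), (tnth t (@Ordinal 4 1 isT)), (tnth t (@Ordinal 4 2 isT)), (tnth t ord_max).
split=> //; apply/eq_from_tnth => -[[|[|[|[|]]]] // i]; congr (tnth _ _); exact/val_inj.
Qed.

Lemma tuple3_ex (op : bool -> bool -> bool -> Prop) (t : 3.-tuple bool) :
  (exists a b c, t = [tuple a; b; c] /\ op a b c) <->
  op (tnth t ord0) (tnth t (@Ordinal 3 1 isT)) (tnth t ord_max).
Proof.
split=> [[a [b [c [-> ]]]] //|tP].
exists (tnth t ord0), (tnth t (@Ordinal 3 1 isT)), (tnth t ord_max); split=> //.
by apply/eq_from_tnth => -[[|[|[|]]] // i]; congr (tnth _ _); exact/val_inj.
Qed.

(** If [f] preserves meets and has a true point, the meet of all its true points is a least true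
    point [m], and [f x] means that [x] lies above [m]. The support of [m] is the set of conjoined
    variables; if it is empty, [f] is constantly true. *)
Lemma conjunctionP (f : bfun) : conjunction f \/ constant_fun f <->
  forall x y, f (meett x y) = f x && f y.
Proof.
split=> [[[A _ fE]|[c fE]] x y|fP].
- rewrite !fE -big_split; apply: eq_bigr => i _; exact: tnth_mktuple.
- by rewrite !fE andbb.
- have [fF|[x0 fx0]] : (forall x, f x = false) \/ exists x, f x.
    have [/existsP|/existsPn H] := boolP [exists x, f x]; first by right.
    by left=> x; apply/negbTE/H.
  + by right; exists false.
  have [m fm mP] : exists2 m, f m & forall x, f x -> forall i, tnth m i -> tnth x i.
    have [m fm mP] : exists2 m, f m & forall x, x \in enum {: (apred f).+1.-tuple bool} ->
       f x -> forall i, tnth m i -> tnth x i.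
      elim: (enum _) => [|x s [m fm mP]]; first by exists x0.
      case fx : (f x); last by exists m => // y; rewrite inE => /orP[/eqP->|/mP//]; rewrite fx.
      exists (meett m x); first by rewrite fP fm fx.
      move=> y; rewrite inE => ys fy i; rewrite tnth_mktuple => /andP[mi xi].
      by case/orP: ys => [/eqP->//|/mP]; apply.
    by exists m => // x; apply: mP; rewrite mem_enum.
  have fE x : f x = [forall i, tnth m i ==> tnth x i].
    apply/idP/forallP => [fx i|H]; first by apply/implyP/mP.
    suff : f (meett m x) by rewrite fP fm.
    rewrite -(_ : m = meett m x) //; apply/eq_from_tnth => i; rewrite tnth_mktuple.
    by have := H i; case: (tnth m i) => // ->.
  pose A := [set i | tnth m i]%SET; have [A0|A0] := eqVneq A finset.set0.
    right; exists true => x; rewrite fE; apply/forallP => i.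
    apply/implyP => mi; suff : i \in A by rewrite A0 inE.
    by rewrite inE.
  left; exists A => // x; rewrite fE big_andE; apply: eq_forallb => i.
  by rewrite inE.
Qed.

Lemma characterized_Lambda : characterized eLambda.
Proof.
apply: characterized_basic => f; rewrite (@preserves3 (fun a b c => a && b = c)).
  rewrite /= conjunctionP; split=> [fP x y|fP x y z xyz].
    by apply/esym/fP => j; rewrite tnth_mktuple.
  by rewrite -fP; congr (f _); apply/eq_from_tnth => j; rewrite tnth_mktuple.
move=> t; exact: (@tuple3_ex (fun a b c => a && b = c)).
Qed.

(** * De Morgan duals and the class of disjunctions *)

Definition dual (f : bfun) : bfun :=
  BFun [ffun x : (apred f).+1.-tuple bool => ~~ f (neg x)].

Lemma negK n : involutive (@neg n).
Proof. by move=> x; apply/eq_from_tnth => i; rewrite !tnth_mktuple negbK. Qed.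

Lemma neg_const n b : neg (const_tuple n b) = const_tuple n (~~ b).
Proof. by apply/eq_from_tnth => i; rewrite !tnth_mktuple. Qed.

Lemma dualE f x : dual f x = ~~ f (neg x).
Proof. by rewrite ffunE. Qed.

Lemma dualV (f : bfun) x : f x = ~~ dual f (neg x).
Proof. by rewrite dualE negK negbK. Qed.

Lemma bfun_ext n (f g : {ffun n.+1.-tuple bool -> bool}) : f =1 g -> BFun f = BFun g.
Proof. by move=> fg; congr BFun; apply/ffunP. Qed.

Lemma dualK : involutive dual.
Proof.
by case=> n f; apply: bfun_ext => x; rewrite ffunE dualE negK negbK.
Qed.

Lemma dual_disjunction f : disjunction (dual f) <-> conjunction f.
Proof.
split=> -[A A0 fE]; exists A => // x; last first.
  rewrite dualE fE big_andE big_orE negb_forall; apply: eq_existsb => i.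
  by rewrite negb_imply tnth_mktuple negbK.
rewrite dualV fE big_andE big_orE negb_exists; apply: eq_forallb => i.
by rewrite negb_and tnth_mktuple negbK implybE.
Qed.

Lemma dual_constant f : constant_fun (dual f) <-> constant_fun f.
Proof.
split=> -[c fE]; exists (~~ c) => x; last by rewrite dualE fE.
by rewrite dualV fE.
Qed.

Definition joint n (x y : n.-tuple bool) : n.-tuple bool :=
  [tuple tnth x i || tnth y i | i < n].

Lemma neg_meett n (x y : n.-tuple bool) : neg (meett x y) = joint (neg x) (neg y).
Proof. by apply/eq_from_tnth => i; rewrite !tnth_mktuple negb_and. Qed.

Lemma disjunctionP (f : bfun) : disjunction f \/ constant_fun f <->
  forall x y, f (joint x y) = f x || f y.
Proof.
rewrite -{1}[f]dualK dual_disjunction -dual_constant conjunctionP.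
split=> fP x y; last by rewrite !dualE neg_meett fP negb_or.
rewrite -[x]negK -[y]negK -neg_meett; apply: negb_inj.
by rewrite negb_or -!dualE fP.
Qed.

Lemma characterized_V : characterized eV.
Proof.
apply: characterized_basic => f; rewrite (@preserves3 (fun a b c => a || b = c)).
  rewrite /= disjunctionP; split=> [fP x y|fP x y z xyz].
    by apply/esym/fP => j; rewrite tnth_mktuple.
  by rewrite -fP; congr (f _); apply/eq_from_tnth => j; rewrite tnth_mktuple.
move=> t; exact: (@tuple3_ex (fun a b c => a || b = c)).
Qed.

Definition unary_like (f : bfun) : Prop :=
  (exists i, forall x, f x = tnth x i) \/ (exists i, forall x, f x = ~~ tnth x i) \/
  constant_fun f.

Definition flip n (i : 'I_n) (x : n.-tuple bool) : n.-tuple bool :=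
  [tuple if j == i then ~~ tnth x j else tnth x j | j < n].

(** The zero tuple is turned into [x] one coordinate at a time, [s] being the coordinates already
    copied; each change is a flip or no change at all. *)
Lemma flip_constant (f : bfun) : (forall x i, f (flip i x) = f x) -> constant_fun f.
Proof.
move=> fP; exists (f (const_tuple _ false)) => x; set o := const_tuple _ _.
have H (s : seq 'I_(apred f).+1) :
    f [tuple if i \in s then tnth x i else tnth o i | i < (apred f).+1] = f o.
  elim: s => [|i s <-]; first by congr (f _); apply/eq_from_tnth => i; rewrite tnth_mktuple.
  set y := [tuple _ | _ < _]; set z := [tuple _ | _ < _].
  have E j : j != i -> tnth y j = tnth z j.
    by move=> ji; rewrite !tnth_mktuple inE (negPf ji).
  have [yz|yz] := eqVneq (tnth y i) (tnth z i).
    congr (f _); apply/eq_from_tnth => j.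
    by have [->//|/E] := eqVneq j i.
  rewrite -(fP z i); congr (f _); apply/eq_from_tnth => j.
  rewrite [RHS]tnth_mktuple; case: eqP => [->|/eqP/E //].
  by move: yz; case: (tnth y i); case: (tnth z i).
rewrite -(H (enum 'I_(apred f).+1)); congr (f _); apply/eq_from_tnth => i.
by rewrite tnth_mktuple mem_enum.
Qed.

(** If flipping coordinate [i] changes the value at some [y], applying the hypothesis to the triples
    ([flip i y], [y], [z]) and ([y], [flip i y], [z]) shows that [f z] depends only on coordinate
    [i] of [z]. *)
Lemma unary_likeP (f : bfun) : unary_like f <->
  forall x y z : (apred f).+1.-tuple bool,
    (forall j, tnth x j = tnth y j \/ tnth y j = tnth z j) -> f x = f y \/ f y = f z.
Proof.
split=> [[[i fE]|[[i fE]|[c fE]]] x y z xyz|fP]; rewrite ?fE; last 2 first.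
- by left.
- have [H|/existsNP[y /existsNP[i fy]]] := pselect (forall x i, f (flip i x) = f x).
    by right; right; apply: flip_constant.
  have E1 z : tnth z i = tnth y i -> f z = f y.
    move=> zi; have [j|//|//] := fP (flip i y) y z.
    by rewrite tnth_mktuple; case: eqP => [->|_]; [right|left].
  have E2 z : tnth z i = ~~ tnth y i -> f z = ~~ f y.
    move=> zi; have [j|E|<-] := fP y (flip i y) z.
    + by rewrite tnth_mktuple; case: eqP => [->|_]; [right|left].
    + by case: fy.
    + by move: fy; case: (f y); case: (f _).
  have E z : f z = if tnth z i == tnth y i then f y else ~~ f y.
    case: eqP => [/E1//|H]; apply: E2; move: H.
    by case: (tnth y i); case: (tnth z i).
  case yi : (tnth y i); case fyE : (f y).
  + by left; exists i => x; rewrite E yi fyE; case: (tnth x i).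
  + by right; left; exists i => x; rewrite E yi fyE; case: (tnth x i).
  + by right; left; exists i => x; rewrite E yi fyE; case: (tnth x i).
  + by left; exists i => x; rewrite E yi fyE; case: (tnth x i).
- by [].
- by case: (xyz i) => ->; [left|right].
Qed.

Lemma characterized_Omega1 : characterized eOmega1.
Proof.
apply: characterized_basic => f; rewrite (@preserves3 (fun a b c => a = b \/ b = c)).
  by rewrite /= -unary_likeP.
move=> t; exact: (@tuple3_ex (fun a b c => a = b \/ b = c)).
Qed.

Lemma characterized_post e : post e -> characterized e.
Proof.
have T0 : characterized eT0 := characterized_const false.
have T1 : characterized eT1 := characterized_const true.
have Uu u : rankU u -> characterized u.
  move=> [m _|]; [exact: characterized_separating|apply: characterized_meet_rank => k].
  exact: characterized_separating.
have Ww u : rankW u -> characterized u.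
  move=> [m _|]; [exact: characterized_separating|apply: characterized_meet_rank => k].
  exact: characterized_separating.
have := (characterized_Omega, characterized_M, characterized_S, characterized_L,
  characterized_Lambda, characterized_V, characterized_Omega1).
by case=> [[[[[[? ?] ?] ?] ?] ?] ?]; case=> *; repeat apply: characterized_meet => //; auto.
Qed.

(** * Clones containing the conjunction *)

Definition inC (C : set bfun) n (F : n.+1.-tuple bool -> bool) : Prop :=
  C (BFun (finfun F)).

(* An operation is represented in [C] by its action on the functions of [C] of
   every arity, which makes composition immediate. *)
Definition op0 (C : set bfun) (b : bool) : Prop := forall n, @inC C n (fun=> b).
Definition op1 (C : set bfun) (o : bool -> bool) : Prop :=
  forall n (F : n.+1.-tuple bool -> bool), inC C F -> inC C (fun x => o (F x)).
Definition op2 (C : set bfun) (o : bool -> bool -> bool) : Prop :=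
  forall n (F G : n.+1.-tuple bool -> bool),
    inC C F -> inC C G -> inC C (fun x => o (F x) (G x)).
Definition op3 (C : set bfun) (o : bool -> bool -> bool -> bool) : Prop :=
  forall n (F G H : n.+1.-tuple bool -> bool),
    inC C F -> inC C G -> inC C H -> inC C (fun x => o (F x) (G x) (H x)).

Lemma inC_bfun C (f : bfun) : inC C f <-> C f.
Proof.
by case: f => n f; rewrite /inC (_ : BFun _ = BFun f) //; apply: bfun_ext => x; rewrite ffunE.
Qed.

Lemma inC_ext C n (F G : n.+1.-tuple bool -> bool) : F =1 G -> inC C F -> inC C G.
Proof. by move=> FG; rewrite /inC (_ : finfun F = finfun G) //; apply/eq_ffun. Qed.

Lemma op1_ext C o o' : o =1 o' -> op1 C o -> op1 C o'.
Proof. by move=> E H n F cF; apply: (inC_ext _ (H _ _ cF)) => x; apply: E. Qed.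

Lemma op2_ext C o o' : o =2 o' -> op2 C o -> op2 C o'.
Proof. by move=> E H n F G cF cG; apply: (inC_ext _ (H _ _ _ cF cG)) => x; apply: E. Qed.

Lemma op3_ext C o o' : (forall u v w, o u v w = o' u v w) -> op3 C o -> op3 C o'.
Proof.
by move=> E H n F G K cF cG cK; apply: (inC_ext _ (H _ _ _ _ cF cG cK)) => x; apply: E.
Qed.

Lemma inC_proj C n (i : 'I_n.+1) : clone C -> inC C (fun x => tnth x i).
Proof. by case=> H _; exact: H. Qed.

Lemma inC_comp C (f : bfun) n (G : 'I_(apred f).+1 -> n.+1.-tuple bool -> bool) :
  clone C -> C f -> (forall i, inC C (G i)) ->
  inC C (fun x => f [tuple G i x | i < (apred f).+1]).
Proof.
case: f G => k f G [_ cC] Cf CG; have := cC k n f (fun i => finfun (G i)) Cf CG.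
congr C; apply: bfun_ext => x; rewrite !ffunE; congr (f _).
by apply/eq_from_tnth => i; rewrite !tnth_mktuple ffunE.
Qed.

Lemma tnth_const n b (i : 'I_n) : tnth (const_tuple n b) i = b.
Proof. exact: tnth_mktuple. Qed.

(** The diagonal of a function of [C] that does not fix the constant tuple [b] is a unary operation
    sending [b] to [~~ b]; its value at [~~ b] makes it the negation or a constant. *)
Lemma not_const_preserving C b : clone C ->
  ~ C `<=` [set f : bfun | f (const_tuple _ b) = b] ->
  op1 C negb \/ op0 C (~~ b).
Proof.
move=> cC /existsNP[f /not_implyP[Cf fb]].
have H : op1 C (fun c => f (const_tuple _ c)) by move=> n F cF; apply: inC_comp.
case E : (f (const_tuple _ (~~ b)) == b).
  left; apply: op1_ext H => c; move/eqP: E fb => E /= /eqP fb.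
  have [->|cb] := eqVneq c b; first by move: fb; case: (f _) => /=; case: (b).
  have -> : c = ~~ b by move: cb; case: (c); case: (b).
  by rewrite E negbK.
right=> n; have := H n _ (inC_proj ord0 cC); apply: inC_ext => x.
have {}E : f (const_tuple (apred f).+1 (~~ b)) = ~~ b.
  by move: E; case: (f _); case: (b).
have {}fb : f (const_tuple (apred f).+1 b) = ~~ b.
  by move/eqP: fb; rewrite /=; case: (f _); case: (b).
by have [->|] := eqVneq (tnth x ord0) b => //; case: (tnth x ord0); case: (b) E fb.
Qed.

Lemma not_T0_true C : clone C -> op2 C orb -> ~ C `<=` eT0.1 -> op0 C true.
Proof.
move=> cC cor /(not_const_preserving cC)[neg|//] n.
have x0 := @inC_proj C n ord0 cC.
by apply: inC_ext (cor _ _ _ x0 (neg _ _ x0)) => x; case: (tnth _ _).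
Qed.

Lemma not_T1_false C : clone C -> op2 C andb -> ~ C `<=` eT1.1 -> op0 C false.
Proof.
move=> cC cand /(not_const_preserving cC)[neg|//] n.
have x0 := @inC_proj C n ord0 cC.
by apply: inC_ext (cand _ _ _ x0 (neg _ _ x0)) => x; case: (tnth _ _).
Qed.

(** Take [x] below [y] with [f x] true and [f y] false. Identifying variables according to whether
    they are true in [x], in [y] only, or in neither gives [o], whose two stated values are [f x]
    and [f y]. *)
Lemma not_monotone C : clone C -> ~ C `<=` monotone ->
  exists o, [/\ op3 C o, o true false false & o true true false = false].
Proof.
move=> cC /existsNP[f /not_implyP[Cf /existsNP[x /existsNP[y]]]].
move=> /not_implyP[xy /not_implyP[fx /negP fy]].
exists (fun u v w =>
  f [tuple if tnth x i then u else if tnth y i then v else w | i < (apred f).+1]).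
split=> [n F G H cF cG cH||].
- apply: (@inC_comp C f n (fun i z =>
    if tnth x i then F z else if tnth y i then G z else H z)) => // i.
  by case: (tnth x i) => //; case: (tnth y i).
- move: fx; congr (is_true (f _)); apply/eq_from_tnth => i.
  by rewrite tnth_mktuple; case: (tnth x i) => //; rewrite if_same.
- apply: negbTE; move: fy; congr (~~ f _); apply/eq_from_tnth => i.
  by rewrite tnth_mktuple; have := xy i; case: (tnth x i) => [->|_] //; case: (tnth y i).
Qed.

(** * Interpolation from the separation of pairs of points *)

(** For a fixed true point, the conjunction of the functions separating it from each false point
    lies below [f]; the disjunction of these conjunctions over all true points is [f]. *)
Lemma lattice_interpolation n (G : (n.-tuple bool -> bool) -> Prop)
    (f : n.-tuple bool -> bool) :
  (forall g h, g =1 h -> G g -> G h) ->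
  (forall g h, G g -> G h -> G (fun x => g x && h x)) ->
  (forall g h, G g -> G h -> G (fun x => g x || h x)) ->
  (exists a, f a) -> (exists b, ~~ f b) ->
  (forall a b, f a -> ~~ f b -> exists g, [/\ G g, g a & ~~ g b]) ->
  G f.
Proof.
move=> Gext Gand Gor [a0 fa0] [b0 fb0] sep.
have H1 a : f a -> exists g, [/\ G g, g a & forall x, g x -> f x].
  move=> fa; suff [g [Gg ga gP]] : exists g, [/\ G g, g a &
      forall x, x \in enum {: n.-tuple bool} -> g x -> f x].
    by exists g; split=> // x; apply: gP; rewrite mem_enum.
  elim: (enum _) => [|b s [g [Gg ga gP]]].
    by have [g [Gg ga _]] := sep _ _ fa fb0; exists g.
  case fb : (f b).
    by exists g; split=> // x; rewrite inE => /orP[/eqP->|/gP].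
  have [h [Gh ha hb]] := sep _ _ fa (negbT fb).
  exists (fun x => g x && h x); split; [exact: Gand|by rewrite ga|] => x.
  by rewrite inE => /orP[/eqP->|/gP gx /andP[/gx]//]; rewrite (negPf hb) andbF.
suff [g [Gg gf fg]] : exists g, [/\ G g, forall x, g x -> f x &
    forall x, x \in enum {: n.-tuple bool} -> f x -> g x].
  apply: Gext Gg => x; apply/idP/idP => [/gf//|]; by apply: fg; rewrite mem_enum.
elim: (enum _) => [|a s [g [Gg gf fg]]].
  by have [g [Gg _ gf]] := H1 _ fa0; exists g.
case fa : (f a); last first.
  by exists g; split=> // x; rewrite inE => /orP[/eqP->|/fg//]; rewrite fa.
have [h [Gh ha hf]] := H1 a fa.
exists (fun x => g x || h x); split; first exact: Gor.
  by move=> x /orP[/gf|/hf].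
by move=> x; rewrite inE => /orP[/eqP->|/fg gx /gx->//]; rewrite ha orbT.
Qed.

Lemma constant_cases n (f : n.-tuple bool -> bool) :
  (exists c, forall x, f x = c) \/ ((exists a, f a) /\ exists b, ~~ f b).
Proof.
have [/existsP Ha|/existsPn H] := boolP [exists a, f a]; last first.
  by left; exists false => x; apply/negbTE/H.
have [/existsP Hb|/existsPn H] := boolP [exists a, ~~ f a]; first by right.
by left; exists true => x; have := H x; rewrite negbK.
Qed.

(* Some variable separates [a] from [b] unless [a <= b]; then a non-monotone
   ternary operation is applied to functions with values (1,1), (0,1) and (0,0)
   at (a,b). *)
Lemma separate_points C n (a b : n.+1.-tuple bool) (f : n.+1.-tuple bool -> bool) :
  clone C -> (C `<=` monotone -> inC monotone f) ->
  (a = const_tuple _ false -> op0 C true) ->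
  (b = const_tuple _ true -> op0 C false) ->
  f a -> ~~ f b -> exists g, [/\ inC C g, g a & ~~ g b].
Proof.
move=> cC fM a0 b1 fa fb.
have [/existsP[i /andP[ai bi]]|/existsPn ab] := boolP [exists i, tnth a i && ~~ tnth b i].
  by exists (fun x => tnth x i); split=> //; apply: inC_proj.
have {}ab i : tnth a i -> tnth b i by move: (ab i); case: (tnth a i); rewrite //= negbK.
have CM : ~ C `<=` monotone.
  by move=> /fM fM'; have := fM' a b ab; rewrite /= !ffunE fa (negPf fb) => /(_ isT).
have [o [oC o1 o0]] := not_monotone cC CM.
have [U [CU Ua Ub]] : exists U, [/\ @inC C n U, U a & U b].
  have [/existsP[i ai]|/existsPn H] := boolP [exists i, tnth a i].
    by exists (fun x => tnth x i); split; [exact: inC_proj| |exact: ab].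
  exists (fun=> true); split=> //; apply: a0; apply/eq_from_tnth => i.
  by rewrite tnth_const; apply/negbTE/H.
have [W [CW Wa Wb]] : exists W, [/\ @inC C n W, W a = false & W b = false].
  have [/existsP[i bi]|/existsPn H] := boolP [exists i, ~~ tnth b i].
    exists (fun x => tnth x i); split; [exact: inC_proj| |exact: negbTE].
    by apply/negP => /ab; apply/negP.
  exists (fun=> false); split=> //; apply: b1; apply/eq_from_tnth => i.
  by rewrite tnth_const; have := H i; rewrite negbK.
have [/existsP[j /andP[aj bj]]|/existsPn H] := boolP [exists i, ~~ tnth a i && tnth b i].
  exists (fun x => o (U x) (tnth x j) (W x)); split.
  - by apply: oC => //; apply: inC_proj.
  - by rewrite Ua Wa (negPf aj).
  - by rewrite Ub Wb bj o0.
suff E : a = b by rewrite E (negPf fb) in fa.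
apply/eq_from_tnth => i; move: (H i) (ab i).
by case: (tnth a i); case: (tnth b i) => //= _ ->.
Qed.

(** Whenever [f] lacks one of the three properties, so does some function of [C]; this supplies the
    constant or the non-monotone operation that separating the points of [f] calls for. *)
Lemma and_or_mem C (f : bfun) : clone C -> op2 C andb -> op2 C orb ->
  (C `<=` eM.1 -> eM.1 f) -> (C `<=` eT0.1 -> eT0.1 f) -> (C `<=` eT1.1 -> eT1.1 f) ->
  C f.
Proof.
move=> cC cand cor fM fT0 fT1; apply/inC_bfun.
have b0 : f (const_tuple _ false) -> op0 C true.
  move=> f0; apply: not_T0_true => // /fT0; rewrite /= -/(const_tuple _ _) => E.
  by rewrite E in f0.
have b1 : ~~ f (const_tuple _ true) -> op0 C false.
  move=> f1; apply: not_T1_false => // /fT1; rewrite /= -/(const_tuple _ _) => E.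
  by rewrite E in f1.
have [[[] fE]|[fa fb]] := constant_cases f.
- have /b0 H : f (const_tuple _ false) by rewrite fE.
  by apply: inC_ext (H _) => x; rewrite fE.
- have /b1 H : ~~ f (const_tuple _ true) by rewrite fE.
  by apply: inC_ext (H _) => x; rewrite fE.
apply: (lattice_interpolation (G := @inC C _)) fa fb _.
- by move=> g h gh; apply: inC_ext.
- by move=> g h; apply: cand.
- by move=> g h; apply: cor.
move=> a b fa fb; apply: (separate_points _ _ _ _ fa fb) => //.
- by move=> /fM; rewrite inC_bfun.
- by move=> E; apply: b0; rewrite E in fa.
- by move=> E; apply: b1; rewrite E in fb.
Qed.

(* [table2 E t] and [table3 E t] show that an operation is available in [C] by
   expressing it as the term [t] over available operations, the truth tables
   being compared with the help of the equations [E]. *)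
Ltac op_tac := rewrite /op1 /op2 /op3; intros; cbv beta; repeat first [assumption | match goal with
  | hop : op0 _ ?c |- inC _ (fun=> ?c) => exact: (hop _)
  | hop : op2 _ andb |- inC _ (fun x => _ && _) => apply: (hop)
  | hop : op1 _ negb |- inC _ (fun x => ~~ _) => apply: (hop)
  | hop : op2 _ orb |- inC _ (fun x => _ || _) => apply: (hop)
  | hop : op1 _ ?o |- inC _ (fun x => ?o _) => apply: (hop)
  | hop : op2 _ ?o |- inC _ (fun x => ?o _ _) => apply: (hop)
  | hop : op3 _ ?o |- inC _ (fun x => ?o _ _ _) => apply: (hop)
  end].

Ltac table2 E t :=
  apply: (op2_ext (o := t)); [by case; case; rewrite ?E | by op_tac].
Ltac table3 E t :=
  apply: (op3_ext (o := t)); [by case; case; case; rewrite ?E | by op_tac].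

(** * Clones containing the conjunction but not the disjunction *)

(** Some [f] in [C] has true points [x] and [y] without a common true coordinate. Identifying
    variables along them gives a binary [o] that is true at (1,0) and (0,1). All four such truth
    tables yield the disjunction, except the constant one. *)
Lemma and_not_U2 C : clone C -> op2 C andb -> ~ C `<=` separating_rank true 2 ->
  op2 C orb \/ op0 C true.
Proof.
move=> cC cand /existsNP[f /not_implyP[Cf]].
rewrite separating_rankP => /existsNP[X /not_implyP[fX /forallNP XP]].
pose x := X ord0; pose y := X ord_max.
pose o u v := f [tuple if tnth x i then u else if tnth y i then v else u && v
                | i < (apred f).+1].
have oC : op2 C o.
  move=> n F G cF cG; apply: (@inC_comp C f n (fun i z =>
    if tnth x i then F z else if tnth y i then G z else F z && G z)) => // i.
  by case: (tnth x i) => //; case: (tnth y i) => //; apply: cand.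
have o10 : o true false = true.
  rewrite -[RHS](fX ord0) -/x; congr (f _); apply/eq_from_tnth => i.
  by rewrite tnth_mktuple; case: (tnth x i); rewrite ?if_same.
have o01 : o false true = true.
  rewrite -[RHS](fX ord_max) -/y; congr (f _); apply/eq_from_tnth => i.
  rewrite tnth_mktuple; case xi : (tnth x i); last by case: (tnth y i).
  apply/esym/negbTE/negP => yi; apply: (XP i) => k.
  by case: k => [[|[|]] // k]; [rewrite -xi|rewrite -yi]; congr (tnth (X _) _); apply/val_inj.
move: (o) oC o10 o01 => {}o oC o10 o01.
case o00 : (o false false); case o11 : (o true true).
- right=> n; have := @inC_proj C n ord0 cC => x0.
  apply: inC_ext (oC _ _ _ x0 x0) => z; by case: (tnth z _).
- left; table2 (o00, o01, o10, o11) (fun u v => o (o u u) (o v v)).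
- left; table2 (o00, o01, o10, o11) o.
- left; table2 (o00, o01, o10, o11) (fun u v => o (o u v) (u && v)).
Qed.

(** The failure of [f] to preserve the meet of [x] and [y] is carried over to a binary minor, with
    the constant true at the coordinates that are true in both. Every truth table violating the meet
    condition produces the disjunction. *)
Lemma and_true_not_Lambda C : clone C -> op2 C andb -> op0 C true ->
  ~ C `<=` eLambda.1 -> op2 C orb.
Proof.
move=> cC cand c1 /existsNP[f /not_implyP[Cf]].
rewrite /= conjunctionP => /existsNP[x /existsNP[y fxy]].
pose o u v := f [tuple if tnth x i then if tnth y i then true else u
                       else if tnth y i then v else u && v | i < (apred f).+1].
have oC : op2 C o.
  move=> n F G cF cG; apply: (@inC_comp C f n (fun i z =>
    if tnth x i then if tnth y i then true else F z
    else if tnth y i then G z else F z && G z)) => // i.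
  by case: (tnth x i); case: (tnth y i) => //; apply: cand.
have oE : o false false != o true false && o false true.
  apply/eqP => H; apply: fxy; move: H; rewrite /o.
  by congr (f _ = f _ && f _); apply/eq_from_tnth => i; rewrite !tnth_mktuple;
    case: (tnth x i); case: (tnth y i).
move: (o) oC oE => {}o oC oE.
case o00 : (o false false) oE; case o10 : (o true false);
case o01 : (o false true); case o11 : (o true true) => // _;
have E := (o00, o01, o10, o11).
- table2 E (fun u v => o v (o v u)).
- table2 E (fun u v => o (o u u && o v v) (o u u && o v v)).
- table2 E (fun u v => o (o u v) v).
- table2 E (fun u v => o (o u u && o v v) (o u u && o v v)).
- table2 E (fun u v => o (o u v) (u && v)).
- table2 E (fun u v => o (o u u && o v v) (o u u && o v v)).
- table2 E o.
- table2 E (fun u v => o (o u v) (u && v)).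
Qed.

(** Here [u] stands in for the constant true: all arguments are cut down to lie below [u]. A
    non-monotone [C] yields a relative complement, and a monotone one yields a relative disjunction
    from two true points whose meet is false. *)
Lemma and_not_Lambda_P C : clone C -> op2 C andb -> ~ C `<=` eLambda.1 ->
  op3 C (fun u v w => u && (v || w)).
Proof.
move=> cC cand CL; have [CM|CM] := pselect (C `<=` monotone); last first.
  have [o [oC o100 o110]] := not_monotone cC CM.
  (* The masking makes the arguments of [o] decreasing, so that only [h true true true] remains
     unknown; for [w] false this is [u && ~~ v]. *)
  pose h u v w := u && o u (u && v) (u && v && w).
  have hC : op3 C h by rewrite /h; op_tac.
  have h0 v w : h false v w = false by [].
  have h1 w : h true false w = true by rewrite /h /= o100.
  have h2 : h true true false = false by rewrite /h /= o110.
  move: (h) hC h0 h1 h2 => {}h hC h0 h1 h2.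
  case h3 : (h true true true).
  - table3 (h0, h1, h2, h3) (fun u v w => h u (h u v w) w).
  - table3 (h0, h1, h2, h3) (fun u v w => h u (h (h u v w) w w) (h (h u v w) w w)).
move: CL => /existsNP[f /not_implyP[Cf]].
rewrite /= conjunctionP => /existsNP[x /existsNP[y fxy]].
have [fx fy fm] : [/\ f x, f y & f (meett x y) = false].
  have fM := CM f Cf.
  case fm : (f (meett x y)) fxy.
    by rewrite (fM _ x _ fm) ?(fM _ y _ fm) // => i; rewrite tnth_mktuple => /andP[].
  by case: (f x); case: (f y).
pose o u v w := u && f [tuple if tnth x i then if tnth y i then u else u && v
                       else if tnth y i then u && w else u && v && w | i < (apred f).+1].
have oC : op3 C o.
  move=> n F G H cF cG cH; apply: (cand) => //; apply: (@inC_comp C f n (fun i z =>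
    if tnth x i then if tnth y i then F z else F z && G z
    else if tnth y i then F z && H z else F z && G z && H z)) => // i.
  by case: (tnth x i); case: (tnth y i); op_tac.
have E0 v w : o false v w = false by [].
have E10 : o true true false = true.
  rewrite /o /= -[RHS]fx; congr (f _); apply/eq_from_tnth => i.
  by rewrite tnth_mktuple; case: (tnth x i); case: (tnth y i).
have E01 : o true false true = true.
  rewrite /o /= -[RHS]fy; congr (f _); apply/eq_from_tnth => i.
  by rewrite tnth_mktuple; case: (tnth x i); case: (tnth y i).
have E00 : o true false false = false.
  rewrite /o /= -[RHS]fm; congr (f _); apply/eq_from_tnth => i.
  by rewrite !tnth_mktuple; case: (tnth x i); case: (tnth y i).
move: (o) oC E0 E10 E01 E00 => {}o oC E0 E10 E01 E00.
case E11 : (o true true true).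
- table3 (E0, E10, E01, E00, E11) o.
- table3 (E0, E10, E01, E00, E11) (fun u v w => o u (o u v w) (v && w)).
Qed.

(** Among functions below the variable [i], the disjunction of [g] and [h] equals
    [tnth x i && (g x || h x)], so these functions of [C] form a lattice and interpolation applies
    to them. *)
Lemma below_mem C n (f : n.+1.-tuple bool -> bool) i :
  clone C -> op2 C andb -> op3 C (fun u v w => u && (v || w)) ->
  C `<=` eT0.1 -> (C `<=` eM.1 -> inC eM.1 f) -> (C `<=` eT1.1 -> inC eT1.1 f) ->
  (forall x, f x -> tnth x i) -> inC C f.
Proof.
move=> cC cand cP CT0 fM fT1 fi.
have xi := @inC_proj C n i cC.
have b1 : ~~ f (const_tuple _ true) -> op0 C false.
  move=> f1; apply: not_T1_false => // /fT1; rewrite /inC /= ffunE -/(const_tuple _ _) => E.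
  by rewrite E in f1.
have [[[] fE]|[fa fb]] := constant_cases f.
- by have := fi (const_tuple _ false); rewrite fE tnth_const => /(_ isT).
- have /b1 H : ~~ f (const_tuple _ true) by rewrite fE.
  by apply: inC_ext (H _) => x; rewrite fE.
suff [] : inC C f /\ forall x, f x -> tnth x i by [].
apply: (lattice_interpolation (G := fun g => inC C g /\ forall x, g x -> tnth x i)) fa fb _.
- by move=> g h gh [Cg gi]; split; [exact: inC_ext Cg|move=> x; rewrite -gh; exact: gi].
- by move=> g h [Cg gi] [Ch hi]; split; [exact: (cand)|move=> x /andP[/gi]].
- move=> g h [Cg gi] [Ch hi]; split; last by move=> x /orP[/gi|/hi].
  apply: inC_ext (cP _ _ _ _ xi Cg Ch) => x.
  case xi' : (tnth x i) => //=; apply/esym/negbTE/norP.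
  by split; apply/negP; [move/gi|move/hi]; rewrite xi'.
move=> a b fa fb; have [||g [Cg ga gb]] := separate_points cC fM _ _ fa fb.
- by move=> E; have := fi a fa; rewrite E tnth_const.
- by move=> E; apply: b1; rewrite E in fb.
exists (fun x => g x && tnth x i); split; last by rewrite (negPf gb).
  by split; [exact: (cand)|move=> x /andP[]].
by rewrite ga fi.
Qed.

Lemma inC_all C n (I : eqType) (G : I -> n.+1.-tuple bool -> bool) (s : seq I) :
  op2 C andb -> s != [::] -> (forall k, inC C (G k)) ->
  inC C (fun x => all (fun k => G k x) s).
Proof.
move=> cand + CG; elim: s => // k [|l s] IH _.
  by apply: inC_ext (CG k) => x; rewrite /= andbT.
by apply: cand => //; apply: IH.
Qed.

(* Each coordinate of a function [g] of [C] is replaced by the conjunction that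
   sends the point whose only false coordinate is [k] to the [k]-th of [m.+1]
   true points of [g] without common true coordinate. *)
Lemma near_unanimity C m : clone C -> op2 C andb -> C `<=` eT0.1 ->
  ~ C `<=` separating_rank true m.+1 ->
  exists h : ('I_m.+1 -> bool) -> bool,
  [/\ forall n (G : 'I_m.+1 -> n.+1.-tuple bool -> bool), (forall k, inC C (G k)) ->
        inC C (fun x => h (fun k => G k x)),
      forall Y, (forall k, Y k = false) -> h Y = false,
      forall Y k0, (forall k, Y k = (k != k0)) -> h Y
    & forall Y : 'I_m.+1 -> bool, (forall k, Y k) -> h Y].
Proof.
move=> cC cand CT0 /existsNP[g /not_implyP[Cg]].
rewrite separating_rankP => /existsNP[X /not_implyP[gX /forallNP XP]].
pose s j := [seq k <- enum 'I_m.+1 | ~~ tnth (X k) j].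
have s0 j : s j != [::].
  apply/negP => /eqP sj; apply: (XP j) => k; apply/negPn/negP => kj.
  by have : k \in s j; [rewrite mem_filter kj mem_enum|rewrite sj].
pose h (Y : 'I_m.+1 -> bool) := g [tuple all Y (s j) | j < (apred g).+1].
have hC n (G : 'I_m.+1 -> n.+1.-tuple bool -> bool) : (forall k, inC C (G k)) ->
    inC C (fun x => h (fun k => G k x)).
  by move=> CG; apply: (inC_comp cC Cg) => j; apply: inC_all.
have h0 Y : (forall k, Y k = false) -> h Y = false.
  move=> Y0; rewrite -[RHS](CT0 _ Cg); congr (g _).
  apply/eq_from_tnth => j; rewrite !tnth_mktuple.
  by case: (s j) (s0 j) => //= k l _; rewrite Y0.
have h1 Y k0 : (forall k, Y k = (k != k0)) -> h Y.
  move=> Yk; have <- : g (X k0) = h Y by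
    congr (g _); apply/eq_from_tnth => j; rewrite tnth_mktuple;
    apply/idP/allP => [kj k|H]; [rewrite mem_filter Yk; apply: contraTneq => ->;
    rewrite kj | apply/negPn/negP => kj; have := H k0; rewrite mem_filter kj mem_enum
    Yk eqxx => /(_ isT)].
  exact: gX.
have hT (Y : 'I_m.+1 -> bool) : (forall k, Y k) -> h Y = g (const_tuple _ true).
  move=> YT; congr (g _); apply/eq_from_tnth => j; rewrite !tnth_mktuple.
  by apply/allP.
case g1 : (g (const_tuple _ true)).
  by exists h; split=> // Y /hT ->.
(* If [h] vanishes at the all-true point then [d u v = u && ~~ v] is available,
   and the first coordinate is made false there. *)
pose d u v := u && h (fun k => if k == ord0 then v else u).
have dE u v : d u v = u && ~~ v.
  rewrite /d; case: u => //=; case: v => /=.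
    by rewrite hT // => k; case: ifP.
  by apply: (h1 _ ord0) => k; case: eqP.
exists (fun Y => h (fun k => if k == ord0 then d (Y ord0) (all Y (enum 'I_m.+1)) else Y k)).
split.
- move=> n G CG; apply: (hC) => k; case: (k == ord0) => //.
  apply: (cand) => //; apply: (hC) => l; case: (l == ord0) => //; apply: inC_all => //.
  by rewrite -size_eq0 size_enum_ord.
- by move=> Y Y0; apply: h0 => k; rewrite /d Y0 /=; case: ifP.
- move=> Y k0 YE; apply: (h1 _ k0) => k; rewrite dE.
  have -> : all Y (enum 'I_m.+1) = false.
    by apply/negP => /allP/(_ k0); rewrite mem_enum YE eqxx => /(_ isT).
  by rewrite andbT; case: eqP => [->|_]; rewrite YE.
- move=> Y YT; apply: (h1 _ ord0) => k; rewrite dE !YT.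
  have -> : all Y (enum 'I_m.+1) by apply/allP.
  by case: eqP.
Qed.

(** The witness is [f] cut down by a variable that is true on all of [A]. *)
Lemma below_separated C (f : bfun) (A : {set (apred f).+1.-tuple bool}) :
  clone C -> op2 C andb -> op3 C (fun u v w => u && (v || w)) -> C `<=` eT0.1 ->
  (C `<=` eM.1 -> eM.1 f) -> (C `<=` eT1.1 -> eT1.1 f) -> separating true A ->
  exists g, [/\ inC C g, forall x, g x -> f x & forall x, x \in A -> f x -> g x].
Proof.
move=> cC cand cP CT0 fM fT1 [i iP].
exists (fun x => f x && tnth x i); split.
- apply: (below_mem (i := i)) => // [/fM fM'|/fT1 fT1'|x /andP[]//].
  + move=> x y xy; rewrite /= !ffunE => /andP[fx xi].
    by rewrite (fM' _ _ xy fx) xy.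
  + by rewrite /inC /= ffunE tnth_mktuple andbT.
- by move=> x /andP[].
- by move=> x xA ->; rewrite iP.
Qed.

(** By induction on [k], any [m + k] true points of [f] are covered by a function of [C] below [f].
    In the step, [G l] covers all the points but the [l]-th, for the first [m.+1] of them. At each
    point at most one [G l] fails, so [h] is true there; and [h] vanishes where all of them do, so
    it stays below [f]. *)
Lemma U_mem C m (f : bfun) :
  clone C -> op2 C andb -> op3 C (fun u v w => u && (v || w)) -> C `<=` eT0.1 ->
  ~ C `<=` separating_rank true m.+1 -> separating_rank true m f ->
  (C `<=` eM.1 -> eM.1 f) -> (C `<=` eT1.1 -> eT1.1 f) -> C f.
Proof.
move=> cC cand cP CT0 CU fU fM fT1.
have [h [hC h0 h1 hT]] := near_unanimity cC cand CT0 CU.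
have H k (s : seq ((apred f).+1.-tuple bool)) : uniq s -> all f s -> (size s <= m + k)%N ->
    exists g, [/\ inC C g, forall x, g x -> f x & forall x, x \in s -> g x].
  elim: k s => [|k IH] s us fs; rewrite ?addn0 ?addnS => sm.
    have [|g [Cg gf fg]] := below_separated (A := [set x in s]%SET) cC cand cP CT0 fM fT1.
      apply: fU; first by move=> x; rewrite inE => /(allP fs).
      by rewrite cardsE; apply: leq_trans (card_size _) sm.
    exists g; split=> // x xs; apply: fg; [by rewrite inE|exact: (allP fs)].
  have [/IH//|ms] := leqP (size s) (m + k); first exact.
  pose x0 := const_tuple (apred f).+1 false.
  have ks (l : 'I_m.+1) : (l < size s)%N.
    by apply: leq_trans (ltn_ord l) _; apply: leq_trans ms; rewrite ltnS leq_addr.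
  have /choice[G GP] (l : 'I_m.+1) : exists g, [/\ inC C g, forall x, g x -> f x &
      forall x, x \in rem (nth x0 s l) s -> g x].
    apply: IH; first exact: rem_uniq.
      by apply/allP => x /mem_rem; apply: (allP fs).
    by rewrite size_rem ?mem_nth// -ltnS prednK // (leq_ltn_trans _ (ks l)).
  exists (fun x => h (fun l => G l x)); split.
  - by apply: hC => l; have [] := GP l.
  - move=> x; have [/existsP[l Gx] _|/existsPn H] := boolP [exists l, G l x].
      by have [_ + _] := GP l; apply.
    by rewrite h0 // => l; apply: negbTE.
  move=> x xs.
  have GE (l : 'I_m.+1) : x != nth x0 s l -> G l x.
    by move=> xl; have [_ _ Gl] := GP l; apply: Gl; rewrite mem_rem_uniq // inE xl.
  have [/forallP|] := boolP [forall l, G l x]; first exact: hT.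
  rewrite negb_forall => /existsP[l0 Gl0]; apply: (h1 _ l0) => l.
  have xl0 : x = nth x0 s l0 by apply/eqP; apply: contraR Gl0 => /GE.
  have [->|ll0] := eqVneq l l0; first exact: negbTE.
  apply: GE; rewrite xl0 nth_uniq //; apply: contra ll0 => /eqP ll0.
  by apply/eqP/val_inj.
have [g [Cg gf fg]] : exists g, [/\ inC C g, forall x, g x -> f x &
    forall x, x \in [seq x <- enum {: (apred f).+1.-tuple bool} | f x] -> g x].
  apply: (H (size [seq x <- enum {: (apred f).+1.-tuple bool} | f x])).
  - by rewrite filter_uniq ?enum_uniq.
  - exact: filter_all.
  - exact: leq_addl.
apply/inC_bfun; apply: inC_ext Cg => x; apply/idP/idP => [/gf//|fx].
by apply: fg; rewrite mem_filter fx mem_enum.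
Qed.

Lemma Uoo_mem C (f : bfun) :
  clone C -> op2 C andb -> op3 C (fun u v w => u && (v || w)) -> C `<=` eT0.1 ->
  eUoo.1 f -> (C `<=` eM.1 -> eM.1 f) -> (C `<=` eT1.1 -> eT1.1 f) -> C f.
Proof.
move=> cC cand cP CT0 fU fM fT1; pose A := [set x | f x]%SET.
have [|g [Cg gf fg]] := below_separated (A := A) cC cand cP CT0 fM fT1.
  (* The rank must be at least 2 to occur in the intersection, and at least the number of true
     points to treat all of them at once. *)
  apply: (fU (maxn 2 #|A|)); rewrite /= ?leq_max ?leqnn ?orbT //.
  by move=> x; rewrite inE.
apply/inC_bfun; apply: inC_ext Cg => x; apply/idP/idP => [/gf//|fx].
by apply: fg; rewrite // inE.
Qed.

(** * From membership criteria to entries of the list *)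

Definition listed (C : set bfun) : Prop := exists e, post e /\ e.1 = C.

Lemma U2_T0 (f : bfun) : separating_rank true 2 f -> eT0.1 f.
Proof.
rewrite separating_rankP => fU; apply/negP => f0.
have [//|j /(_ ord0)] := fU (fun=> const_tuple _ false).
by rewrite tnth_const.
Qed.

(** Either [C] lies in some [U_m] but not in [U_(m+1)], and a near-unanimity operation is available,
    or its rank never stops growing and [C] lies in [U_oo]. *)
Lemma rankU_mem C : clone C -> op2 C andb -> ~ C `<=` eLambda.1 ->
  C `<=` separating_rank true 2 ->
  exists u, [/\ rankU u, C `<=` u.1 & forall f, u.1 f ->
    (C `<=` eM.1 -> eM.1 f) -> (C `<=` eT1.1 -> eT1.1 f) -> C f].
Proof.
move=> cC cand CL CU2; have cP := and_not_Lambda_P cC cand CL.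
have CT0 : C `<=` eT0.1 by move=> f /CU2/U2_T0.
have [H|/existsNP[m /not_implyP[m2 /not_implyP[CU CU']]]] := pselect
    (forall m, (2 <= m)%N -> C `<=` separating_rank true m ->
       C `<=` separating_rank true m.+1); last first.
  exists (eU m); split=> //; first exact: rankU_fin.
  by move=> f fU fM fT1; apply: (U_mem (m := m)).
exists eUoo; split; first exact: rankU_oo.
  have CU d : C `<=` separating_rank true d.+2.
    by elim: d => [//|d IH]; apply: H.
  by move=> f Cf [|[|d]] // _; apply: CU.
by move=> f; apply: Uoo_mem.
Qed.

Lemma meetE e1 e2 f : (meet e1 e2).1 f = (e1.1 f /\ e2.1 f).
Proof. by []. Qed.

(** The fact [mem] puts the class of the entry [pf] inside [C]; the converse is assembled from the
    inclusions of [C] found in the context. *)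
Ltac listed_by pf mem := eexists; split; [exact: pf|];
  apply/seteqP; split=> f; rewrite /eMc /eTc /eI ?meetE;
  [ have := mem f; tauto
  | try done; move=> Cf;
    repeat match goal with H : _ `<=` _ |- _ => have {H} := H f Cf end; tauto].

Lemma and_or_listed C : clone C -> op2 C andb -> op2 C orb -> listed C.
Proof.
move=> cC cand cor; have mem f := @and_or_mem C f cC cand cor.
have [cM|cM] := pselect (C `<=` eM.1); have [c0|c0] := pselect (C `<=` eT0.1);
have [c1|c1] := pselect (C `<=` eT1.1).
- listed_by post_Mc mem.
- listed_by post_M0 mem.
- listed_by post_M1 mem.
- listed_by post_M mem.
- listed_by post_Tc mem.
- listed_by post_T0 mem.
- listed_by post_T1 mem.
- listed_by post_Omega mem.
Qed.

Lemma neg_and_or C : op1 C negb -> op2 C andb -> op2 C orb.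
Proof.
move=> cneg cand; apply: (op2_ext (o := fun u v => ~~ (~~ u && ~~ v))); last by op_tac.
by case; case.
Qed.

Lemma Lambda_listed C :
  clone C -> op2 C andb -> ~ op2 C orb -> C `<=` eLambda.1 -> listed C.
Proof.
move=> cC cand ncor cL.
have mem f : eLambda.1 f -> (C `<=` eT0.1 -> eT0.1 f) -> (C `<=` eT1.1 -> eT1.1 f) -> C f.
  move=> fL fT0 fT1; apply/inC_bfun; case: fL => [[A A0 fE]|[c fE]].
    apply: inC_ext (inC_all (G := fun i x => tnth x i) (s := enum A) cand _ _) => [x||i].
    + by rewrite fE -big_all big_enum.
    + by rewrite -size_eq0 -cardE cards_eq0.
    + exact: inC_proj.
  apply: (@inC_ext _ _ (fun=> c)) => [x|]; first by rewrite fE.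
  case: c fE => fE.
    (* Negation and conjunction would give the disjunction, so the missing preservation can only
       come from the constant. *)
    have /(not_const_preserving cC)[neg|] : ~ C `<=` eT0.1 by move=> /fT0; rewrite /= fE.
      by case: ncor; apply: neg_and_or.
    exact.
  have /(not_const_preserving cC)[neg|] : ~ C `<=` eT1.1 by move=> /fT1; rewrite /= fE.
    by case: ncor; apply: neg_and_or.
  exact.
have [c0|c0] := pselect (C `<=` eT0.1); have [c1|c1] := pselect (C `<=` eT1.1).
- listed_by post_Lambdac mem.
- listed_by post_Lambda0 mem.
- listed_by post_Lambda1 mem.
- listed_by post_Lambda mem.
Qed.

Lemma and_listed C : clone C -> op2 C andb -> listed C.
Proof.
move=> cC cand; have [cor|ncor] := pselect (op2 C orb); first exact: and_or_listed.
have [cL|cL] := pselect (C `<=` eLambda.1); first exact: Lambda_listed.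
have [CU|/(and_not_U2 cC cand)[//|c1]] := pselect (C `<=` separating_rank true 2); last first.
  by case: ncor; apply: and_true_not_Lambda.
have [u [uU cU mem]] := rankU_mem cC cand cL CU.
have u0 f : u.1 f -> eT0.1 f.
  case: uU => [m m2 fU|fU]; last exact/U2_T0/fU.
  apply: U2_T0 => A Af A2; apply: fU => //; exact: leq_trans m2.
have c0 : C `<=` eT0.1 by move=> f /cU/u0.
have {}mem f := mem f; have {}u0 f := u0 f.
have [cM|cM] := pselect (C `<=` eM.1); have [c1|c1] := pselect (C `<=` eT1.1).
- listed_by (post_McU uU) mem.
- listed_by (post_MU uU) mem.
- listed_by (post_TcU uU) mem.
- listed_by (post_U uU) mem.
Qed.

(** * Duality *)

Definition dualC (C : set bfun) : set bfun := [set f | C (dual f)].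

Lemma dualCK : involutive dualC.
Proof. by move=> C; apply/seteqP; split=> f; rewrite /dualC /= dualK. Qed.

Lemma inC_dualC C n (F : n.+1.-tuple bool -> bool) :
  inC (dualC C) F <-> inC C (fun x => ~~ F (neg x)).
Proof.
rewrite /inC /dualC /= (_ : dual _ = BFun [ffun x => ~~ F (neg x)]) //.
by apply: bfun_ext => x; rewrite !ffunE.
Qed.

Lemma clone_dualC C : clone C -> clone (dualC C).
Proof.
move=> cC; split=> [n i|n m f g Cf Cg].
  apply/inC_dualC; apply: inC_ext (inC_proj i cC) => x.
  by rewrite tnth_mktuple negbK.
apply/inC_dualC.
have Cg' i : inC C (fun x => ~~ g i (neg x)).
  by apply/inC_dualC; have := Cg i; rewrite -inC_bfun.
apply: inC_ext (inC_comp cC Cf Cg') => x; rewrite dualE; congr (~~ f _).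
by apply/eq_from_tnth => i; rewrite !tnth_mktuple negbK.
Qed.

Lemma op2_dualC C o : op2 C o -> op2 (dualC C) (fun u v => ~~ o (~~ u) (~~ v)).
Proof.
move=> oC n F G /inC_dualC cF /inC_dualC cG; apply/inC_dualC.
by apply: inC_ext (oC _ _ _ cF cG) => x; rewrite !negbK.
Qed.

Lemma op2_dualC_and C : op2 C orb -> op2 (dualC C) andb.
Proof. by move=> /op2_dualC; apply: op2_ext; case; case. Qed.

Lemma op2_dualC_or C : op2 C andb -> op2 (dualC C) orb.
Proof. by move=> /op2_dualC; apply: op2_ext; case; case. Qed.

Definition dual_entries (e e' : entry) : Prop := forall f, e'.1 f <-> e.1 (dual f).

Lemma dual_entries_meet e1 e1' e2 e2' : dual_entries e1 e1' -> dual_entries e2 e2' ->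
  dual_entries (meet e1 e2) (meet e1' e2').
Proof. by move=> H1 H2 f; rewrite !meetE H1 H2. Qed.

Lemma dual_Omega : dual_entries eOmega eOmega.
Proof. by []. Qed.

Lemma dual_T0 : dual_entries eT0 eT1.
Proof.
move=> f; rewrite /= ffunE -/(const_tuple _ _) neg_const /=.
by case: (f _).
Qed.

Lemma dual_T1 : dual_entries eT1 eT0.
Proof.
move=> f; rewrite /= ffunE -/(const_tuple _ _) neg_const /=.
by case: (f _).
Qed.

Lemma dual_M : dual_entries eM eM.
Proof.
have H f : monotone f -> monotone (dual f).
  move=> fM x y xy; rewrite !dualE; apply: contra; apply: fM => i.
  by rewrite !tnth_mktuple; apply/contra/xy.
by move=> f; split=> [/H//|/H]; rewrite dualK.
Qed.

Lemma dual_S : dual_entries eS eS.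
Proof.
have H f : selfdual f -> selfdual (dual f).
  by move=> fS x; rewrite !dualE [in LHS]fS.
by move=> f; split=> [/H//|/H]; rewrite dualK.
Qed.

Lemma dual_L : dual_entries eL eL.
Proof.
have H f : affine f -> affine (dual f).
  rewrite !affineP => fL x y z; rewrite !dualE.
  have -> : neg (addt (addt x y) z) = addt (addt (neg x) (neg y)) (neg z).
    apply/eq_from_tnth => i; rewrite !tnth_mktuple.
    by case: (tnth x i); case: (tnth y i); case: (tnth z i).
  by rewrite fL; do 3 case: (f _).
by move=> f; split=> [/H//|/H]; rewrite dualK.
Qed.

Lemma dual_V : dual_entries eV eLambda.
Proof. by move=> f; rewrite /= dual_disjunction dual_constant. Qed.

Lemma dual_Lambda : dual_entries eLambda eV.
Proof. by move=> f; have := dual_V (dual f); rewrite dualK => H; apply: iff_sym. Qed.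

Lemma dual_Omega1 : dual_entries eOmega1 eOmega1.
Proof.
have H f : unary_like f -> unary_like (dual f).
  case=> [[i fE]|[[i fE]|fc]].
  - by left; exists i => x; rewrite dualE fE tnth_mktuple negbK.
  - by right; left; exists i => x; rewrite dualE fE tnth_mktuple negbK.
  - by right; right; apply/dual_constant.
by move=> f; split=> [/H//|/H]; rewrite dualK.
Qed.

Lemma dual_separating b m (f : bfun) :
  separating_rank b m f -> separating_rank (~~ b) m (dual f).
Proof.
rewrite !separating_rankP => fP X XP.
have [i|j jP] := fP (fun i => neg (X i)).
  by have := XP i; rewrite dualE => /negb_inj.
by exists j => i; have := jP i; rewrite tnth_mktuple => <-; rewrite negbK.
Qed.

Lemma dual_U m : dual_entries (eU m) (eW m).
Proof.
move=> f; split=> [/dual_separating //|/dual_separating].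
by rewrite dualK.
Qed.

Lemma dual_W m : dual_entries (eW m) (eU m).
Proof.
move=> f; split=> [/dual_separating //|/dual_separating].
by rewrite dualK.
Qed.

Lemma dual_rankU u : rankU u -> exists2 w, rankW w & dual_entries u w.
Proof.
case=> [m m2|]; first by exists (eW m); [exact: rankW_fin|exact: dual_U].
exists eWoo; first exact: rankW_oo.
by move=> f; split=> H k k2; apply/dual_U/H.
Qed.

Lemma dual_rankW w : rankW w -> exists2 u, rankU u & dual_entries w u.
Proof.
case=> [m m2|]; first by exists (eU m); [exact: rankU_fin|exact: dual_W].
exists eUoo; first exact: rankU_oo.
by move=> f; split=> H k k2; apply/dual_W/H.
Qed.

Ltac dual_by pf := eexists; [exact: pf |
  by repeat first [assumption | exact: dual_Omega | exact: dual_T0 | exact: dual_T1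
    | exact: dual_M | exact: dual_S | exact: dual_L | exact: dual_V | exact: dual_Lambda
    | exact: dual_Omega1 | apply: dual_entries_meet]].

(** Duality permutes the list: it exchanges [T_0] with [T_1], the [U] classes with the [W] classes
    and [Lambda] with [V], and fixes [M], [S], [L] and [Omega(1)]. *)
Lemma dual_post e : post e -> exists2 e', post e' & dual_entries e e'.
Proof.
have dTc : dual_entries eTc eTc.
  move=> f; rewrite /eTc !meetE (dual_T0 f) (dual_T1 f); tauto.
have dMc := dual_entries_meet dual_M dTc.
have dI := dual_entries_meet dual_Omega1 dual_M.
case.
- dual_by post_Omega.
- dual_by post_T1.
- dual_by post_T0.
- dual_by post_Tc.
- dual_by post_M.
- dual_by post_M1.
- dual_by post_M0.
- dual_by post_Mc.
- dual_by post_S.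
- dual_by post_Sc.
- dual_by post_SM.
- dual_by post_L.
- dual_by post_L1.
- dual_by post_L0.
- dual_by post_LS.
- dual_by post_Lc.
- by move=> u /dual_rankU[w rw duw]; dual_by (post_W rw).
- by move=> u /dual_rankU[w rw duw]; dual_by (post_TcW rw).
- by move=> u /dual_rankU[w rw duw]; dual_by (post_MW rw).
- by move=> u /dual_rankU[w rw duw]; dual_by (post_McW rw).
- by move=> u /dual_rankW[w rw duw]; dual_by (post_U rw).
- by move=> u /dual_rankW[w rw duw]; dual_by (post_TcU rw).
- by move=> u /dual_rankW[w rw duw]; dual_by (post_MU rw).
- by move=> u /dual_rankW[w rw duw]; dual_by (post_McU rw).
- dual_by post_V.
- dual_by post_V1.
- dual_by post_V0.
- dual_by post_Vc.
- dual_by post_Lambda.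
- dual_by post_Lambda1.
- dual_by post_Lambda0.
- dual_by post_Lambdac.
- dual_by post_Omega1.
- dual_by post_Istar.
- dual_by post_I.
- dual_by post_I1.
- dual_by post_I0.
- dual_by post_Ic.
Qed.

Lemma listed_dualC C : listed (dualC C) -> listed C.
Proof.
case=> e [/dual_post[e' pe' de] eC]; exists e'; split=> //.
by rewrite -[C]dualCK -eC; apply/seteqP; split=> f /de.
Qed.

(** * Clones containing neither the conjunction nor the disjunction *)

Definition no_lattice_op (C : set bfun) : Prop := ~ op2 C andb /\ ~ op2 C orb.

(** The excluded truth tables are the eight with an odd number of ones; each of them produces the
    conjunction or the disjunction. *)
Lemma binary_affine C o : no_lattice_op C -> op2 C o ->
  o true true = o true false (+) o false true (+) o false false.
Proof.
move=> [nand nor] oC.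
case o00 : (o false false); case o01 : (o false true);
case o10 : (o true false); case o11 : (o true true) => //;
have E := (o00, o01, o10, o11).
- by case: nand; table2 E (fun u v => o (o u v) (o u v)).
- by case: nor; table2 E (fun u v => o (o u v) v).
- by case: nor; table2 E (fun u v => o u (o u v)).
- by case: nor; table2 E (fun u v => o (o u v) (o u v)).
- by case: nor; table2 E o.
- by case: nand; table2 E (fun u v => o (o u v) v).
- by case: nand; table2 E (fun u v => o u (o u v)).
- by case: nand; table2 E o.
Qed.

Lemma affine_of_add (f : bfun) :
  (forall x y, f (addt x y) = f x (+) f y (+) f (const_tuple _ false)) -> affine f.
Proof. by move=> fD; apply/affineP => x y z; rewrite !fD; do 4 case: (f _). Qed.

(** Variables are identified according to their values in [x] and [y]: [u] for both true, [v] and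
    [w] for exactly one, [c] for none. Additivity of [f] at [x] and [y] thus becomes a statement
    about four values of [g]. *)
Lemma quaternary_minor C (f : bfun) (x y : (apred f).+1.-tuple bool) : clone C -> C f ->
  exists g : bool -> bool -> bool -> bool -> bool,
  [/\ forall n (F G H K : n.+1.-tuple bool -> bool),
        inC C F -> inC C G -> inC C H -> inC C K ->
        inC C (fun z => g (F z) (G z) (H z) (K z)),
      g false true true false = f (addt x y), g true true false false = f x,
      g true false true false = f y &
      g false false false false = f (const_tuple _ false)].
Proof.
move=> cC Cf.
exists (fun u v w c => f [tuple if tnth x i then if tnth y i then u else v
                          else if tnth y i then w else c | i < (apred f).+1]).
split.
- move=> n F G H K cF cG cH cK; apply: (@inC_comp C f n (fun i z =>
    if tnth x i then if tnth y i then F z else G z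
    else if tnth y i then H z else K z)) => // i.
  by case: (tnth x i); case: (tnth y i).
all: rewrite /=; congr (f _); apply/eq_from_tnth => i; rewrite !tnth_mktuple;
  by case: (tnth x i); case: (tnth y i).
Qed.

(** Setting one of the first three arguments of [g], and the last one, to false leaves binary
    operations, which are affine. In the sum of the three resulting equations the term
    [g true false false false] cancels. *)
Lemma false_affine C : clone C -> no_lattice_op C -> op0 C false -> C `<=` eL.1.
Proof.
move=> cC nl c0 f Cf; apply: affine_of_add => x y.
have [g [gC <- <- <- <-]] := quaternary_minor x y cC Cf.
have c0' n : @inC C n (fun=> false) := c0 n.
have P1 : op2 C (fun v w => g false v w false) by move=> n F G *; apply: gC.
have P2 : op2 C (fun u w => g u false w false) by move=> n F G *; apply: gC.
have P3 : op2 C (fun u v => g u v false false) by move=> n F G *; apply: gC.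
rewrite (binary_affine nl P1 : g false true true false = _).
rewrite (binary_affine nl P2 : g true false true false = _).
rewrite (binary_affine nl P3 : g true true false false = _).
by do 4 case: (g _ _ _ _).
Qed.

Lemma no_lattice_op_dualC C : no_lattice_op C -> no_lattice_op (dualC C).
Proof.
by move=> [nand nor]; split=> [/op2_dualC_or|/op2_dualC_and]; rewrite dualCK.
Qed.

Lemma const_affine C c : clone C -> no_lattice_op C -> op0 C c -> C `<=` eL.1.
Proof.
move=> cC nl; case: c => c0; last exact: false_affine.
move=> f Cf; apply/(dual_L f).
apply: (false_affine (clone_dualC cC) (no_lattice_op_dualC nl)).
  by move=> n; apply/inC_dualC; apply: c0.
by rewrite /dualC /= dualK.
Qed.

(** A function with equal values at [x] and at its negation has a binary minor with equal values at
    (1,0) and (0,1). Being affine, this minor also agrees at (0,0) and (1,1), so its diagonal is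
    constant. *)
Lemma not_selfdual_const C : clone C -> no_lattice_op C -> ~ C `<=` eS.1 ->
  exists c, op0 C c.
Proof.
move=> cC nl /existsNP[f /not_implyP[Cf /existsNP[x fx]]].
pose o u v := f [tuple if tnth x i then u else v | i < (apred f).+1].
have oC : op2 C o.
  move=> n F G cF cG; apply: (@inC_comp C f n (fun i z => if tnth x i then F z else G z)) => // i.
  by case: (tnth x i).
have oE : o true false = o false true.
  have -> : o true false = f x.
    by congr (f _); apply/eq_from_tnth => i; rewrite tnth_mktuple; case: (tnth x i).
  have -> : o false true = f [tuple ~~ tnth x i | i < (apred f).+1].
    by congr (f _); apply/eq_from_tnth => i; rewrite !tnth_mktuple; case: (tnth x i).
  by move: fx; case: (f x); case: (f _).
have := binary_affine nl oC; rewrite oE addbb addFb => o11.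
exists (o false false) => n; have x0 := @inC_proj C n ord0 cC.
by apply: inC_ext (oC _ _ _ x0 x0) => z; case: (tnth z _).
Qed.

(** The constants or the negation needed for [o] come from the failures of [C] to preserve constants
    or self-duality. Both constants together do not provide the negation, hence the last
    hypothesis. *)
Lemma unary_mem C o : clone C -> no_lattice_op C ->
  (C `<=` eT0.1 -> o false = false) -> (C `<=` eT1.1 -> o true = true) ->
  (C `<=` eS.1 -> o true = ~~ o false) ->
  (o =1 negb -> op0 C true -> op0 C false -> op1 C negb) -> op1 C o.
Proof.
move=> cC nl oT0 oT1 oS oneg.
have T0 : o false = true -> op1 C negb \/ op0 C true.
  by move=> o0; apply: (not_const_preserving (b := false) cC) => /oT0; rewrite o0.
have T1 : o true = false -> op1 C negb \/ op0 C false.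
  by move=> o1; apply: (not_const_preserving (b := true) cC) => /oT1; rewrite o1.
have S c : o true = c -> o false = c -> op1 C negb -> op0 C c.
  move=> o1 o0 neg; have [c' Cc'] : exists c', op0 C c'.
    by apply: not_selfdual_const => // /oS; rewrite o1 o0; case: (c).
  have [->|cc'] := eqVneq c c'; first by [].
  move=> n; apply: (@inC_ext _ _ (fun=> ~~ c')); first by case: (c) cc'; case: (c').
  exact: neg.
case o0 : (o false); case o1 : (o true).
- have [neg|c1] := T0 o0; last first.
    by move=> n F _; apply: inC_ext (c1 n) => x; case: (F x).
  by move=> n F _; apply: inC_ext (S _ o1 o0 neg n) => x; case: (F x).
- have on : o =1 negb by case.
  apply: (op1_ext (o := negb)); first by move=> c; rewrite on.
  have [//|c1] := T0 o0; have [//|c0] := T1 o1.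
  exact: oneg.
- by move=> n F cF; apply: inC_ext cF => x; case: (F x).
- have [neg|c0] := T1 o1; last first.
    by move=> n F _; apply: inC_ext (c0 n) => x; case: (F x).
  by move=> n F _; apply: inC_ext (S _ o1 o0 neg n) => x; case: (F x).
Qed.

Lemma const_tuple_le n (i : 'I_n) :
  tnth (const_tuple n false) i -> tnth (const_tuple n true) i.
Proof. by rewrite !tnth_const. Qed.

Lemma unary_like_facts (f : bfun) : unary_like f ->
  [/\ eT0.1 f -> eM.1 f, eT1.1 f -> eM.1 f, eM.1 f -> eS.1 f -> eT0.1 f /\ eT1.1 f &
      eT0.1 f -> eT1.1 f -> eS.1 f].
Proof.
move=> fU.
have proj i : (forall x, f x = tnth x i) ->
    [/\ eT0.1 f, eT1.1 f, eM.1 f & eS.1 f].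
  move=> fE; split; rewrite /= ?fE ?tnth_mktuple // => x.
    by move=> y xy; rewrite !fE; apply: xy.
  by rewrite !fE tnth_mktuple negbK.
case: fU => [[i /proj[]//]|[[i fE]|[c fE]]].
  have n0 : ~ eT0.1 f by rewrite /= fE tnth_mktuple.
  have n1 : ~ eT1.1 f by rewrite /= fE tnth_mktuple.
  split=> // fM; exfalso.
  by have := fM _ _ (@const_tuple_le _); rewrite !fE !tnth_const => /(_ isT).
have fM : eM.1 f by move=> x y _; rewrite !fE.
split=> //; first by move=> _ /(_ (const_tuple _ true)); rewrite !fE; case: (c).
by rewrite /= !fE => ->.
Qed.

Lemma Omega1_listed C : clone C -> no_lattice_op C -> C `<=` eOmega1.1 -> listed C.
Proof.
move=> cC nl cU.
have mem f : eOmega1.1 f -> (C `<=` eM.1 -> eM.1 f) -> (C `<=` eT0.1 -> eT0.1 f) ->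
    (C `<=` eT1.1 -> eT1.1 f) -> (C `<=` eS.1 -> eS.1 f) -> C f.
  move=> fU fM fT0 fT1 fS; apply/inC_bfun.
  have [i [o fE]] : exists i o, forall x, f x = o (tnth x i).
    case: fU => [[i fE]|[[i fE]|[c fE]]].
    - by exists i, id.
    - by exists i, negb.
    - by exists ord0, (fun=> c).
  suff oC : op1 C o by apply: inC_ext (oC _ _ (inC_proj i cC)) => x; rewrite fE.
  apply: unary_mem => // [/fT0|/fT1|/fS H|on _ _].
  - by rewrite /= fE tnth_mktuple.
  - by rewrite /= fE tnth_mktuple.
  - by have := H (const_tuple _ true); rewrite !fE !tnth_mktuple.
  (* As negation is not monotone, [C] contains a non-monotone function, which among essentially
     unary functions must be a negated projection. *)
  have : ~ C `<=` eM.1.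
    by move=> /fM /(_ _ _ (@const_tuple_le _)); rewrite !fE !on !tnth_const => /(_ isT).
  move=> /existsNP[g /not_implyP[Cg gM]].
  have gC : op1 C (fun c => g (const_tuple _ c)) by move=> n F cF; apply: inC_comp.
  case: (cU _ Cg) gM => [[j gE]|[[j gE]|[c gE]]] gM.
  - by case: gM => x y xy; rewrite !gE; apply: xy.
  - by apply: op1_ext gC => c; rewrite gE tnth_const.
  - by case: gM => x y xy; rewrite !gE.
have facts f : C f -> _ := fun Cf => unary_like_facts (cU f Cf).
have f1 : C `<=` eT0.1 -> C `<=` eM.1 by move=> H f Cf; have [+ _ _ _] := facts f Cf; apply; apply: H.
have f2 : C `<=` eT1.1 -> C `<=` eM.1 by move=> H f Cf; have [_ + _ _] := facts f Cf; apply; apply: H.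
have f3 : C `<=` eM.1 -> C `<=` eS.1 -> C `<=` eT0.1.
  by move=> H1 H2 f Cf; have [_ _ + _] := facts f Cf; case; [exact: H1|exact: H2|].
have f4 : C `<=` eM.1 -> C `<=` eS.1 -> C `<=` eT1.1.
  by move=> H1 H2 f Cf; have [_ _ + _] := facts f Cf; case; [exact: H1|exact: H2|].
have f5 : C `<=` eT0.1 -> C `<=` eT1.1 -> C `<=` eS.1.
  by move=> H1 H2 f Cf; have [_ _ _ +] := facts f Cf; apply; [exact: H1|exact: H2].
have facts' f : (eOmega1.1 f -> (eM.1 f -> eS.1 f -> eT0.1 f /\ eT1.1 f) /\
    (eT0.1 f -> eT1.1 f -> eS.1 f) /\ (eT0.1 f -> eM.1 f) /\ (eT1.1 f -> eM.1 f)).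
  by case/unary_like_facts; tauto.
have {}mem f := conj (facts' f) (mem f).
(* The implications above rule out ten of the sixteen combinations. *)
have [cM|cM] := pselect (C `<=` eM.1); have [c0|c0] := pselect (C `<=` eT0.1);
have [c1|c1] := pselect (C `<=` eT1.1); have [cS|cS] := pselect (C `<=` eS.1); try tauto.
- listed_by post_Ic mem.
- listed_by post_I0 mem.
- listed_by post_I1 mem.
- listed_by post_I mem.
- listed_by post_Istar mem.
- listed_by post_Omega1 mem.
Qed.

(** * Clones of affine functions *)

(** An affine function depending on two variables [i] and [j] has the ternary minor
    [c0 (+) u (+) v (+) (p && w)]; nesting it in itself cancels [c0]. *)
Lemma affine_not_unary_add3 C : clone C -> C `<=` eL.1 -> ~ C `<=` eOmega1.1 ->
  op3 C (fun u v w => u (+) v (+) w).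
Proof.
move=> cC cL /existsNP[f /not_implyP[Cf nU]].
have [c0 [c fE]] := cL f Cf.
have [i ci] : exists i, c i.
  apply: contrapT => /forallNP nc; apply: nU; right; right; exists c0 => x.
  by rewrite fE big1 ?addbF // => i _; rewrite (negbTE (introN idP (nc i))).
have [j cj ji] : exists2 j, c j & j != i.
  apply: contrapT => nc.
  have {}fE x : f x = c0 (+) tnth x i.
    rewrite fE (bigD1 i) //= ci big1 ?addbF // => j ji; case cj : (c j) => //.
    by case: nc; exists j.
  apply: nU; case: c0 fE => fE.
    by right; left; exists i.
  by left; exists i.
pose o u v w := f [tuple if k == i then u else if k == j then v else w | k < (apred f).+1].
have oC : op3 C o.
  move=> n F G H cF cG cH; apply: (@inC_comp C f n (fun k z =>
    if k == i then F z else if k == j then G z else H z)) => // k.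
  by case: (k == i); case: (k == j).
pose p := \big[addb/false]_(k | (k != i) && (k != j)) c k.
have oE u v w : o u v w = c0 (+) u (+) v (+) (p && w).
  rewrite /o fE (bigD1 i) //= (bigD1 j) //= !tnth_mktuple ci cj eqxx (negbTE ji) eqxx /= !addbA.
  congr (_ (+) _); rewrite /p; case: w.
    rewrite andbT; apply: eq_bigr => k /andP[/negbTE ki /negbTE kj].
    by rewrite tnth_mktuple ki kj andbT.
  rewrite andbF big1 // => k /andP[/negbTE ki /negbTE kj].
  by rewrite tnth_mktuple ki kj andbF.
move: (o) oC oE => {}o oC oE; case: p oE => oE.
  apply: (op3_ext (o := fun u v w => o (o u v w) w w)); last by op_tac.
  by case; case; case; rewrite !oE; case: (c0).
apply: (op3_ext (o := fun u v w => o (o u v u) w u)); last by op_tac.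
by case; case; case; rewrite !oE; case: (c0).
Qed.

Lemma affine_facts (f : bfun) : affine f -> eT0.1 f -> eT1.1 f -> eS.1 f.
Proof.
move=> /affineP fL f0 f1 x.
have -> : [tuple ~~ tnth x i | i < (apred f).+1] =
    addt (addt x (const_tuple _ true)) (const_tuple _ false).
  apply/eq_from_tnth => i; rewrite !tnth_mktuple.
  by case: (tnth x i).
have {}f0 : f (const_tuple _ false) = false := f0.
have {}f1 : f (const_tuple _ true) = true := f1.
by rewrite fL f0 f1; case: (f x).
Qed.

Lemma selfdual_facts (f : bfun) : selfdual f ->
  (eT0.1 f <-> eT1.1 f) /\ (eM.1 f -> eT0.1 f).
Proof.
move=> fS; have E : f (const_tuple _ true) = ~~ f (const_tuple _ false).
  rewrite fS; congr (~~ f _); exact: neg_const.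
split; first by rewrite /= -!/(const_tuple _ _) E; case: (f _).
move=> fM; have := fM _ _ (@const_tuple_le _); rewrite E /= -/(const_tuple _ _).
by case: (f _) => // /(_ isT).
Qed.

Lemma L_listed C : clone C -> no_lattice_op C -> C `<=` eL.1 -> listed C.
Proof.
move=> cC nl cL; have [cU|cU] := pselect (C `<=` eOmega1.1); first exact: Omega1_listed.
have add3 := affine_not_unary_add3 cC cL cU.
have mem f : eL.1 f -> (C `<=` eT0.1 -> eT0.1 f) ->
    (C `<=` eT1.1 -> eT1.1 f) -> (C `<=` eS.1 -> eS.1 f) -> C f.
  move=> [c0 [c fE]] fT0 fT1 fS; apply/inC_bfun.
  have x0 := @inC_proj C (apred f) ord0 cC.
  have oC : op1 C (fun b => f (const_tuple _ b)).
    apply: unary_mem => // [/fS H|_ c1 c0'].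
      by have := H (const_tuple _ true); rewrite -/(neg _) neg_const.
    move=> n F cF; apply: inC_ext (add3 _ _ _ _ cF (c1 n) (c0' n)) => x.
    by case: (F x).
  (* The function is rewritten as its diagonal at the first variable plus the terms
     [tnth x i (+) tnth x ord0] with nonzero coefficient. Each term adds two variables at once,
     which the ternary sum can do. *)
  pose D s (x : (apred f).+1.-tuple bool) :=
    \big[addb/false]_(i <- s) (c i && (tnth x i (+) tnth x ord0)).
  have H s : inC C (fun x => f (const_tuple _ (tnth x ord0)) (+) D s x).
    elim: s => [|i s IH].
      apply: inC_ext (oC _ _ x0) => x; by rewrite /D big_nil addbF.
    apply: (@inC_ext _ _ (fun x => if c i then
       (f (const_tuple _ (tnth x ord0)) (+) D s x) (+) tnth x i (+) tnth x ord0
       else f (const_tuple _ (tnth x ord0)) (+) D s x)).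
      move=> x; rewrite [in RHS]/D big_cons -/(D s x); case: (c i) => //=.
      by rewrite -addbA addbAC -addbA.
    by case: (c i) => //; apply: add3 => //; apply: inC_proj.
  apply: inC_ext (H (index_enum _)) => x; rewrite !fE -addbA /D; congr (_ (+) _).
  rewrite -big_split /=; apply: eq_bigr => i _; rewrite tnth_const.
  by case: (c i); case: (tnth x i); case: (tnth x ord0).
have facts f : eL.1 f -> (eT0.1 f -> eT1.1 f -> eS.1 f) /\
   (eS.1 f -> (eT0.1 f <-> eT1.1 f)).
  by move=> fL; split; [exact: affine_facts|move=> /selfdual_facts[]].
have f1 : C `<=` eT0.1 -> C `<=` eT1.1 -> C `<=` eS.1.
  by move=> H1 H2 f Cf; apply: (facts f (cL f Cf)).1; [exact: H1|exact: H2].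
have f2 : C `<=` eS.1 -> C `<=` eT0.1 -> C `<=` eT1.1.
  by move=> H1 H2 f Cf; apply/((facts f (cL f Cf)).2 (H1 f Cf))/H2.
have f3 : C `<=` eS.1 -> C `<=` eT1.1 -> C `<=` eT0.1.
  by move=> H1 H2 f Cf; apply/((facts f (cL f Cf)).2 (H1 f Cf))/H2.
have {}mem f := conj (facts f) (mem f).
have [c0|c0] := pselect (C `<=` eT0.1); have [c1|c1] := pselect (C `<=` eT1.1);
have [cS|cS] := pselect (C `<=` eS.1); try tauto.
- listed_by post_Lc mem.
- listed_by post_L0 mem.
- listed_by post_L1 mem.
- listed_by post_LS mem.
- listed_by post_L mem.
Qed.

(** * Clones of self-dual functions containing the majority *)

Definition maj u v w := (u && v) || (u && w) || (v && w).

(** As in the Baker-Pixley theorem: given at least three points, interpolants omitting the first,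
    the second and the third are combined by the majority, and at each point at least two of them
    are right. *)
Lemma majority_interpolation C n (f : n.+1.-tuple bool -> bool) : op3 C maj ->
  (forall a b, exists g, [/\ inC C g, g a = f a & g b = f b]) -> inC C f.
Proof.
move=> cmaj f2.
have H k (s : seq (n.+1.-tuple bool)) : (size s <= k)%N ->
    exists g, inC C g /\ forall x, x \in s -> g x = f x.
  elim: k s => [|k IH] [|a [|b [|c s]]] //= sk.
  1,2: by have [g [Cg _ _]] := f2 (const_tuple _ true) (const_tuple _ true); exists g.
  - by have [g [Cg ga _]] := f2 a a; exists g; split=> // x; rewrite inE => /eqP->.
  - have [g [Cg ga gb]] := f2 a b; exists g; split=> // x.
    by rewrite !inE => /orP[] /eqP->.
  have [g1 [C1 g1E]] := IH (b :: c :: s) sk.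
  have [g2 [C2 g2E]] := IH (a :: c :: s) sk.
  have [g3 [C3 g3E]] := IH (a :: b :: s) sk.
  exists (fun x => maj (g1 x) (g2 x) (g3 x)); split; first exact: cmaj.
  move=> x; rewrite !inE => /or4P[/eqP xE|/eqP xE|/eqP xE|xs].
  - rewrite (g2E x) ?(g3E x) ?inE ?xE ?eqxx ?orbT //.
    by rewrite /maj; case: (f a); case: (g1 a).
  - rewrite (g1E x) ?(g3E x) ?inE ?xE ?eqxx ?orbT //.
    by rewrite /maj; case: (f b); case: (g2 b).
  - rewrite (g1E x) ?(g2E x) ?inE ?xE ?eqxx ?orbT //.
    by rewrite /maj; case: (f c); case: (g3 c).
  - rewrite g1E ?g2E ?g3E ?inE ?xs ?orbT //.
    by rewrite /maj; case: (f x).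
have [g [Cg gE]] := H _ (enum {: n.+1.-tuple bool}) (leqnn _).
by apply: inC_ext Cg => x; rewrite gE ?mem_enum.
Qed.

Lemma op3_selfdual C o : clone C -> C `<=` eS.1 -> op3 C o ->
  forall u v w, o (~~ u) (~~ v) (~~ w) = ~~ o u v w.
Proof.
move=> cC cS oC u v w.
have p i := @inC_proj C 2 i cC.
have := cS _ (oC _ _ _ _ (p ord0) (p (@Ordinal 3 1 isT)) (p ord_max)) [tuple u; v; w].
by rewrite /= !ffunE !tnth_mktuple /= => ->; rewrite negbK.
Qed.

(** Self-duality determines [g] from its four values with last argument false, so the inequality
    leaves eight truth tables. *)
Lemma maj_of_nonaffine C g : clone C -> C `<=` eS.1 -> op3 C g ->
  g true true false != g true false false (+) g false true false (+) g false false false ->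
  op3 C maj.
Proof.
move=> cC cS gC; have gS := op3_selfdual cC cS gC.
case g00 : (g false false false); case g01 : (g false true false);
case g10 : (g true false false); case g11 : (g true true false) => // _;
move: (gS false false false) (gS false true false) (gS true false false)
  (gS true true false) => /=; rewrite ?(g00, g01, g10, g11) /= => h00 h01 h10 h11;
have E := (g00, g01, g10, g11, h00, h01, h10, h11).
- table3 E (fun u v w => g (g u u u) (g v v v) (g w w w)).
- table3 E (fun u v w => g (g u v u) v (g w v w)).
- table3 E (fun u v w => g u (g u v v) (g u w w)).
- table3 E (fun u v w => g (g u u w) (g v v w) w).
- table3 E (fun u v w => g u v (g u v w)).
- table3 E (fun u v w => g (g u v w) v w).
- table3 E (fun u v w => g u (g u v w) w).
- table3 E g.
Qed.

(** The argument for clones with the constant false is repeated with an additional variable [z] in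
    place of that constant, so the minors become ternary. *)
Lemma selfdual_not_affine_maj C : clone C -> C `<=` eS.1 -> ~ C `<=` eL.1 -> op3 C maj.
Proof.
move=> cC cS /existsNP[f /not_implyP[Cf fL]].
have [x [y fxy]] : exists x y, f (addt x y) <> f x (+) f y (+) f (const_tuple _ false).
  apply: contrapT => H; apply: fL; apply: affine_of_add => x y.
  by apply: contrapT => fxy; apply: H; exists x, y.
have [g [gC E1 E2 E3 E4]] := quaternary_minor x y cC Cf.
move: fxy; rewrite -E1 -E2 -E3 -E4 => {E1 E2 E3 E4} fxy.
apply: contrapT => nmaj.
have aff o : op3 C o -> o true true false =
    o true false false (+) o false true false (+) o false false false.
  by move=> oC; apply/eqP; apply: contrapT => /negP H; apply: nmaj; apply: maj_of_nonaffine H.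
have P1 : op3 C (fun v w z => g z v w z) by move=> n F G H *; apply: gC.
have P2 : op3 C (fun u w z => g u z w z) by move=> n F G H *; apply: gC.
have P3 : op3 C (fun u v z => g u v z z) by move=> n F G H *; apply: gC.
apply: fxy; rewrite (aff _ P1 : g false true true false = _).
rewrite (aff _ P2 : g true false true false = _).
rewrite (aff _ P3 : g true true false false = _).
by do 4 case: (g _ _ _ _).
Qed.

Lemma S_listed C : clone C -> C `<=` eS.1 -> op3 C maj -> listed C.
Proof.
move=> cC cS cmaj.
have mem f : eS.1 f -> (C `<=` eM.1 -> eM.1 f) -> (C `<=` eT0.1 -> eT0.1 f) -> C f.
  move=> fS fM fT0.
  have sep a b : f a -> ~~ f b -> exists g, [/\ inC C g, g a & ~~ g b].
    (* If [C] preserves false, then [f] fixes both constant tuples and no constants are needed for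
       separation. Otherwise the negation serves at any coordinate where [a] and [b] differ, since a
       constant is not self-dual. *)
    move=> fa fb; have [c0|/(not_const_preserving cC)[neg|c1]] := pselect (C `<=` eT0.1).
    - apply: (separate_points cC _ _ _ fa fb); first by move=> /fM; rewrite inC_bfun.
        move=> E; move: fa; rewrite E.
        by have : f (const_tuple _ false) = false := fT0 c0; move=> ->.
      move=> E; move: fb; rewrite E.
      have : f (const_tuple _ true) = true := (selfdual_facts fS).1.1 (fT0 c0).
      by move=> ->.
    - have [i iE] : exists i, tnth a i != tnth b i.
        apply/existsP; apply: contraTT fa => /existsPn H.
        suff -> : a = b by [].
        by apply/eq_from_tnth => i; have := H i; rewrite negbK => /eqP.
      have xi := @inC_proj C (apred f) i cC.
      case ai : (tnth a i) iE; case bi : (tnth b i) => // _.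
        by exists (fun x => tnth x i); split; rewrite ?ai ?bi.
      by exists (fun x => ~~ tnth x i); split; rewrite ?ai ?bi //; apply: neg.
    - have := cS _ (c1 0%N) [tuple false].
      by rewrite /= !ffunE.
  have sd g : @inC C (apred f) g -> forall x, g (neg x) = ~~ g x.
    by move=> /cS H x; have := H x; rewrite /= !ffunE -/(neg x) => ->; rewrite negbK.
  have fN x : f (neg x) = ~~ f x by rewrite [f x]fS negbK.
  apply/inC_bfun; apply: majority_interpolation => // a b.
  (* Replacing a point by its negation negates the values of [f] and of every function of [C], so
     each case reduces to separating a true point from a false one. *)
  case fa : (f a); case fb : (f b).
  - have [||g [Cg ga gb]] := sep a (neg b); rewrite ?fN ?fb //.
    by exists g; split=> //; move: gb; rewrite sd // negbK.
  - have [||g [Cg ga gb]] := sep a b; rewrite ?fb //.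
    by exists g; split=> //; apply: negbTE.
  - have [||g [Cg gb ga]] := sep b a; rewrite ?fa //.
    by exists g; split=> //; apply: negbTE.
  - have [||g [Cg ga gb]] := sep (neg a) b; rewrite ?fN ?fa ?fb //.
    by exists g; split=> //; apply: negbTE => //; move: ga; rewrite sd.
have f1 : C `<=` eM.1 -> C `<=` eT0.1.
  by move=> H f Cf; apply: (selfdual_facts (cS f Cf)).2; apply: H.
have {}mem f := conj (@selfdual_facts f : eS.1 f -> _) (mem f).
have f2 f := @selfdual_facts f : eS.1 f -> _.
have [cM|cM] := pselect (C `<=` eM.1); have [c0|c0] := pselect (C `<=` eT0.1); try tauto.
- listed_by post_SM mem.
- eexists; split; [exact: post_Sc|]; apply/seteqP; split=> f; rewrite /eTc !meetE.
    by have := mem f; tauto.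
  by move=> Cf; have := f2 f (cS f Cf); have := cS f Cf; have := c0 f Cf; tauto.
- listed_by post_S mem.
Qed.

Lemma post_classification C : clone C -> listed C.
Proof.
move=> cC; have [cand|nand] := pselect (op2 C andb); first exact: and_listed.
have [cor|nor] := pselect (op2 C orb).
  by apply/listed_dualC/and_listed; [exact: clone_dualC|exact: op2_dualC_and].
have nl : no_lattice_op C by [].
have [cL|cL] := pselect (C `<=` eL.1); first exact: L_listed.
have [cS|/(not_selfdual_const cC nl)[c cc]] := pselect (C `<=` eS.1).
  by apply: S_listed => //; apply: selfdual_not_affine_maj.
by case: cL; apply: const_affine cc.
Qed.

(** * Threshold functions *)

Section Threshold.
Import Order.TTheory GRing.Theory Num.Theory.
Local Open Scope ring_scope.

(** This chooses the eliminated coordinate between its lower and upper bounds; either list of bounds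
    may be empty. *)
Lemma exists_between (R : realFieldType) (T U : eqType) (P : seq T) (N : seq U)
    (l : T -> R) (u : U -> R) :
  (forall p n, p \in P -> n \in N -> l p < u n) ->
  exists c, (forall p, p \in P -> l p < c) /\ (forall n, n \in N -> c < u n).
Proof.
elim: P => [_|p P IH H].
  elim: N => [|n N [c [_ H]]]; first by exists 0.
  exists (Num.min c (u n - 1)); split=> // m; rewrite inE gt_min.
  by case/orP => [/eqP->|/H ->//]; rewrite ltrBlDr ltrDl ltr01 orbT.
have [|c [cP cN]] := IH; first by move=> q n qP; apply: H; rewrite inE qP orbT.
have [d [dP dN]] : exists d, l p < d /\ forall n, n \in N -> d < u n.
  have {H IH cP cN} : forall n, n \in N -> l p < u n.
    by move=> n; apply: H; rewrite inE eqxx.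
  elim: N => [_|n N IH H]; first by exists (l p + 1); rewrite ltrDl ltr01.
  have [|d [dP dN]] := IH; first by move=> m mN; apply: H; rewrite inE mN orbT.
  have ln := H n (mem_head _ _).
  exists (Num.min d ((l p + u n) / 2%:R)); split; first by rewrite lt_min dP /=; lra.
  move=> m; rewrite inE gt_min => /orP[/eqP->|/dN ->//].
  by apply/orP; right; lra.
exists (Num.max c d); split=> [q|n nN]; last by rewrite gt_max cN ?dN.
by rewrite inE lt_max => /orP[/eqP->|/cP ->//]; rewrite dP orbT.
Qed.

(* Gordan's alternative for integer vectors, by Fourier-Motzkin elimination of
   the last coordinate. *)
Lemma gordan (R : realFieldType) d (T : eqType) (v : T -> nat -> int)
    (s : seq T) :
  (exists w : nat -> R,
     forall x, x \in s -> 0 < \sum_(i < d) w i * (v x i)%:~R) \/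
  (exists l, [/\ l != [::], {subset l <= s} &
     forall i, (i < d)%N -> \sum_(x <- l) v x i = 0]).
Proof.
elim: d T v s => [|d IH] T v s.
  case: s => [|x s]; first by left; exists (fun=> 0).
  right; exists [:: x]; split=> // y; rewrite inE => /eqP->; exact: mem_head.
pose P := [seq x <- s | 0 < v x d]; pose N := [seq x <- s | v x d < 0].
pose Z := [seq x <- s | v x d == 0].
(* Vectors with last coordinate zero are kept; a vector with positive and one with negative last
   coordinate are combined, with positive coefficients, so that this coordinate cancels. *)
pose v' (t : T + T * T) i := match t with
  | inl z => v z i
  | inr (p, n) => v p d * v n i - v n d * v p i end.
pose s' := [seq inl z | z <- Z] ++ [seq inr (p, n) | p <- P, n <- N].
have [[w wP]|[l [l0 ls lP]]] := IH _ v' s'.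
  left.
  pose dot x : R := \sum_(i < d) w i * (v x i)%:~R.
  have dotpn p n : p \in P -> n \in N ->
      - dot p / (v p d)%:~R < dot n / - (v n d)%:~R.
    move=> pP nN; have : 0 < \sum_(i < d) w i * (v' (inr (p, n)) i)%:~R.
      by apply: wP; rewrite mem_cat; apply/orP; right; apply/allpairsP; exists (p, n).
    have -> : \sum_(i < d) w i * (v' (inr (p, n)) i)%:~R =
              (v p d)%:~R * dot n - (v n d)%:~R * dot p :> R.
      rewrite !mulr_sumr -sumrB; apply: eq_bigr => i _ /=.
      by rewrite intrB !intrM mulrBr mulrCA [w i * (_ * _)]mulrCA.
    move: pP nN; rewrite !mem_filter => /andP[p0 _] /andP[n0 _].
    rewrite subr_gt0 => H.
    rewrite ltr_pdivrMr ?ltr0z// mulrAC ltr_pdivlMr ?oppr_gt0 ?ltrz0//.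
    by rewrite mulrNN mulrC [X in _ < X]mulrC.
  have [c [cP cN]] := exists_between dotpn.
  exists (fun i => if i == d then c else w i) => x xs.
  rewrite big_ord_recr /= eqxx.
  rewrite (eq_bigr (fun i : 'I_d => w i * (v x i)%:~R)); last first.
    by move=> i _; rewrite ltn_eqF.
  rewrite -/(dot x); case: (ltrgt0P (v x d)) => vx.
  - have := cP x; rewrite mem_filter vx xs => /(_ isT).
    by rewrite ltr_pdivrMr ?ltr0z// -subr_gt0 opprK addrC.
  - have := cN x; rewrite mem_filter vx xs => /(_ isT).
    by rewrite ltr_pdivlMr ?oppr_gt0 ?ltrz0// mulrN -subr_gt0 opprK.
  - rewrite vx mulr0 addr0; have := wP (inl x); rewrite /s' mem_cat => -> //.
    by apply/orP; left; rewrite mem_map ?mem_filter ?vx ?xs// => ? ? [].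
right.
(* The integer coefficients of a combination are realized by repetition, so that a vanishing sum of
   combined vectors is again a plain sum over a list of the original ones. *)
pose ex (t : T + T * T) := match t with
  | inl z => [:: z]
  | inr (p, n) => nseq `|v n d| p ++ nseq `|v p d| n end.
have exP t : t \in s' -> [/\ ex t != [::], {subset ex t <= s},
    \sum_(x <- ex t) v x d = 0 & forall i, \sum_(x <- ex t) v x i = v' t i].
  rewrite mem_cat => /orP[/mapP[z]|/allpairsP[[p n] /= []]].
    rewrite mem_filter => /andP[/eqP z0 zs] -> /=.
    split=> //; first by move=> y; rewrite inE => /eqP->.
      by rewrite big_seq1.
    by move=> i; rewrite big_seq1.
  rewrite !mem_filter => /andP[p0 ps] /andP[n0 ns] -> /=.
  have E i : \sum_(x <- nseq `|v n d| p ++ nseq `|v p d| n) v x i =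
             v p d * v n i - v n d * v p i.
    have S k x : \sum_(y <- nseq k x) v y i = k%:Z * v x i.
      elim: k => [|k IHk]; first by rewrite big_nil mul0r.
      by rewrite /= big_cons IHk intS mulrDl mul1r.
    by rewrite big_cat /= !S !abszE (gtr0_norm p0) (ltr0_norm n0) mulNr addrC.
  split=> //.
  - rewrite -size_eq0 size_cat !size_nseq addn_eq0 !absz_eq0.
    by rewrite (gt_eqF p0) andbF.
  - move=> x; rewrite mem_cat !mem_nseq.
    by case/orP => /andP[_ /eqP->].
  - by rewrite E mulrC subrr.
exists (flatten (map ex l)); split.
- case: l l0 ls {lP} => // t l _ ls.
  have [] := exP t (ls _ (mem_head _ _)).
  by rewrite /= -!size_eq0 size_cat addn_eq0; case: (size (ex t)).
- by move=> x /flattenP[_ /mapP[t tl ->]]; have [_ + _ _] := exP _ (ls _ tl); exact.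
- move=> i; rewrite ltnS leq_eqVlt big_flatten big_map => /orP[/eqP->|id].
    rewrite big_seq big1// => t tl; by have [] := exP _ (ls _ tl).
  rewrite -[RHS](lP i id) big_seq [RHS]big_seq; apply: eq_bigr => t tl.
  by have [_ _ _ ->] := exP _ (ls _ tl).
Qed.

(** * Threshold functions and the constraints [B n] *)

Lemma tnth_blockl n (a b : bool) (i : 'I_n) :
  tnth [tuple of nseq n a ++ nseq n b] (lshift n i) = a.
Proof. by rewrite (tnth_nth false) nth_cat size_nseq /= ltn_ord nth_nseq ltn_ord. Qed.

Lemma tnth_blockr n (a b : bool) (i : 'I_n) :
  tnth [tuple of nseq n a ++ nseq n b] (rshift n i) = b.
Proof.
by rewrite (tnth_nth false) nth_cat size_nseq /= ltnNge leq_addr /= addKn nth_nseq ltn_ord.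
Qed.

(** The two halves of the rows have equal total weight. A forbidden output would put every row of
    one half below the threshold and every row of the other at or above it, making the totals differ
    strictly. *)
Lemma threshold_cPol (R : realType) f : threshold R f -> cPol Bs f.
Proof.
move=> [w [t fP]] q [[//|m] _ <-] a aP /=.
pose row i := [tuple tnth (a j) i | j < (apred f).+1].
pose dot (x : (apred f).+1.-tuple bool) := \sum_j w j * (tnth x j)%:R : R.
have E : \sum_(i < m.+1) dot (row (lshift m.+1 i)) =
         \sum_(i < m.+1) dot (row (rshift m.+1 i)).
  rewrite exchange_big [RHS]exchange_big; apply: eq_bigr => j _.
  rewrite -!mulr_sumr; congr (_ * _).
  have := congr1 (fun k => k%:R : R) (aP j); rewrite /= !natr_sum => H.
  by under eq_bigr do rewrite tnth_mktuple; rewrite H; apply: eq_bigr => i _;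
    rewrite tnth_mktuple.
have sep (h1 h2 : 'I_m.+1 -> 'I_(m.+1 + m.+1)) :
    (forall i, f (row (h1 i)) = false) -> (forall i, f (row (h2 i)) = true) ->
    \sum_i dot (row (h1 i)) < \sum_i dot (row (h2 i)).
  move=> H1 H2; apply: ltr_sum; first by apply/hasP; exists ord0; rewrite ?mem_index_enum.
  move=> i _; apply: (@lt_le_trans _ _ t); last exact/fP.
  by rewrite ltNge; apply/negP => /fP; rewrite H1.
have ft h b : (forall i, tnth [tuple f (row i) | i < m.+1 + m.+1] (h i) = b) ->
    forall i : 'I_m.+1, f (row (h i)) = b.
  by move=> H i; rewrite -(H i) tnth_mktuple.
case=> /= yE; suff: \sum_(i < m.+1) dot (row (lshift m.+1 i)) !=
    \sum_(i < m.+1) dot (row (rshift m.+1 i)) by rewrite E eqxx.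
  by rewrite lt_eqF//; apply: sep; apply: ft => i; rewrite yE ?tnth_blockl ?tnth_blockr.
by rewrite eq_sym; rewrite lt_eqF//; apply: sep; apply: ft => i; rewrite yE ?tnth_blockl ?tnth_blockr.
Qed.

Lemma cPol_threshold (R : realType) f : cPol Bs f -> threshold R f.
Proof.
move=> fB; pose n := (apred f).+1.
(* Position [n] carries the constant 1 appended to [x]; its weight, negated, becomes the
   threshold. *)
pose v (x : n.-tuple bool) i : int :=
  (if f x then 1 else -1) * (if (i < n)%N then (nth false x i)%:Z else 1).
have [[w wP]|[l [l0 _ lP]]] := gordan R n.+1 v (enum {: n.-tuple bool}).
  exists w, (- w n) => x; have := wP x; rewrite mem_enum => /(_ isT).
  pose s := \sum_i w (@nat_of_ord n i) * (tnth x i)%:R.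
  have -> : \sum_(i < n.+1) w i * (v x i)%:~R = (if f x then 1 else -1) * (s + w n) :> R.
    rewrite big_ord_recr /v ltnn /= mulr1 mulrDr mulr_sumr; congr (_ + _).
      apply: eq_bigr => i _; rewrite ltn_ord (tnth_nth false) intrM mulrCA.
      by case: (f x).
    by rewrite mulrC; case: (f x).
  rewrite -/s; case: (f x) => H; split=> //.
    by move=> _; move: H; rewrite mul1r -subr_ge0 opprK => /ltW.
  by move: H; rewrite mulN1r oppr_gt0 -subr_ge0 opprK ltNge => /negPf->.
(* The vanishing signed sum says that the true points [l1] and the false points [l2] have the same
   sum in each coordinate; coordinate [n] says that they are equally many. *)
exfalso; pose l1 := [seq x <- l | f x]; pose l2 := [seq x <- l | ~~ f x].
pose u i (x : n.-tuple bool) : nat := if (i < n)%N then nth false x i else 1.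
have lE i : (i < n.+1)%N -> (\sum_(x <- l2) u i x = \sum_(x <- l1) u i x)%N.
  move=> i_n; apply/eqP; rewrite -eqz_nat -!natz !natr_sum eq_sym -subr_eq0.
  apply/eqP; rewrite -sumrN -[RHS](lP i i_n) [RHS](bigID f) /= !big_filter.
  by congr (_ + _); apply: eq_bigr => x; rewrite /v /u natz; [move->|move/negPf->];
    rewrite ?mul1r ?mulN1r; case: ifP.
have szE : size l2 = size l1.
  by have := lE n (ltnSn n); rewrite /u ltnn !sum1_size.
(* Both lists are doubled so that the index [N + N] is at least 2 even when [N] is 1. The false
   points come first, which makes the output the first forbidden tuple. *)
pose L := (l2 ++ l2) ++ (l1 ++ l1); set N := size l1 in szE.
have N0 : (0 < N)%N.
  rewrite lt0n; apply/negP => /eqP N0; case/negP: l0; rewrite -size_eq0.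
  by rewrite -(count_predC f l) -!size_filter -/l1 -/N N0 -/l2 szE N0.
have sz2 : size (l2 ++ l2) = (N + N)%N by rewrite size_cat szE.
have sz1 : size (l1 ++ l1) = (N + N)%N by rewrite size_cat.
pose x0 := [tuple false | _ < n].
have Ll (i : 'I_(N + N)) : nth x0 L (lshift (N + N) i) = nth x0 (l2 ++ l2) i.
  by rewrite nth_cat sz2 /= ltn_ord.
have Lr (i : 'I_(N + N)) : nth x0 L (rshift (N + N) i) = nth x0 (l1 ++ l1) i.
  by rewrite nth_cat sz2 /= ltnNge leq_addr /= addKn.
pose a (j : 'I_n) := [tuple tnth (nth x0 L i) j | i < (N + N) + (N + N)].
have BN : Bs (B (N + N)) by exists (N + N)%N => //=; lia.
case: (fB _ BN a) => [j /=|].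
  have sumE l' : size l' = (N + N)%N ->
      (\sum_(i < N + N) tnth (nth x0 l' i) j = \sum_(x <- l') u j x)%N.
    move=> <-; rewrite (big_nth x0) big_mkord; apply: eq_bigr => i _.
    by rewrite /u ltn_ord (tnth_nth false).
  under eq_bigr do rewrite tnth_mktuple Ll.
  under [RHS]eq_bigr do rewrite tnth_mktuple Lr.
  by rewrite !sumE// !big_cat /= !lE// ltnW // ltnS ltn_ord.
left; apply/eq_from_tnth => i; rewrite tnth_mktuple.
have -> : [tuple tnth (a j) i | j < n] = nth x0 L i.
  by apply/eq_from_tnth => j; rewrite !tnth_mktuple.
case: (split_ordP i) => k ->.
  rewrite Ll tnth_blockl; apply/negP/negP.
  have : nth x0 (l2 ++ l2) k \in l2 ++ l2 by rewrite mem_nth ?sz2.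
  by rewrite mem_cat orbb mem_filter => /andP[].
rewrite Lr tnth_blockr.
have : nth x0 (l1 ++ l1) k \in l1 ++ l1 by rewrite mem_nth ?sz1.
by rewrite mem_cat orbb mem_filter => /andP[].
Qed.

End Threshold.

Theorem theorem2p7 (R : realType) :
  cPol Bs = threshold R /\
  forall C : set bfun, clone C ->
    C `&` threshold R = cPol (Bs `|` constraints_of C).
Proof.
have BsE : cPol Bs = threshold R.
  by apply/seteqP; split=> f; [exact: cPol_threshold|exact: threshold_cPol].
split=> // C cC; rewrite -BsE; apply/seteqP; split=> f.
  move=> [Cf fB] q [/fB//|[e [pe eC] eq]].
  by have := characterized_post pe; rewrite /characterized eC => E; rewrite -E in Cf; exact: Cf.
move=> fP; split; last by move=> q Bq; apply: fP; left.
(* The union [constraints_of C] would be empty for an unlisted clone; the classification provides an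
   entry for [C], whose constraints [f] then preserves. *)
have [e [pe eC]] := post_classification cC.
rewrite -eC -(characterized_post pe) => q eq.
by apply: fP; right; exists e.
Qed.
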